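(* Let $G_m$ be a bounded Vilenkin group and let $\{q_k:k\ge0\}$ be a non-increasing sequence of non-negative numbers with $q_0>0$. a) Let $0<p<1/2$. Then there exists an absolute constant $c_p$, depending only on $p$ (the sequence $m$ being fixed), such that for every $f\in H_p$ $$\sum_{k=1}^{\infty}\frac{\|T_kf\|_p^p}{k^{2-2p}}\le c_p\|f\|_{H_p}^p .$$ b) Suppose in addition that $$\frac1{Q_n}=O\left(\frac1n\right)\quad\text{as }n\to\infty .$$ Then there exists an absolute constant $c$ (for the given $m$ and $\{q_k\}$; in particular independent of $f$ and $n$) such that for every $f\in H_{1/2}$ and every integer $n\ge2$ $$\frac1{\log n}\sum_{k=1}^{n}\frac{\|T_kf\|_{1/2}^{1/2}}{k}\le c\,\|f\|_{H_{1/2}}^{1/2}.$$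
   Context: Let $m=(m_0,m_1,\ldots)$ be a fixed sequence of integers $m_k\ge 2$ with $\sup_k m_k<\infty$. $G_m=\prod_{k\ge0}Z_{m_k}$, $Z_{m_k}=\{0,\ldots,m_k-1\}$ the integers mod $m_k$, is the bounded Vilenkin group with product (of discrete) topology and normalized Haar measure $\mu$. $I_0(x)=G_m$, $I_n(x)=\{y\in G_m: y_0=x_0,\ldots,y_{n-1}=x_{n-1}\}$. $M_0=1$, $M_{k+1}=m_kM_k$; every $n\in\mathbb{N}$ is uniquely $n=\sum_j n_jM_j$ with $n_j\in Z_{m_j}$. $r_k(x)=\exp(2\pi i x_k/m_k)$ and $\psi_n=\prod_k r_k^{n_k}$ (Vilenkin system). $\mathbb{N}=\{0,1,2,\ldots\}$. For $f\in L_1(G_m)$: $\widehat f(n)=\int_{G_m} f\overline{\psi_n}\,d\mu$; $S_0f=0$, $S_nf=\sum_{k=0}^{n-1}\widehat f(k)\psi_k$. $\|g\|_p=(\int_{G_m}|g|^pd\mu)^{1/p}$. Let $\mathcal F_n$ be the $\sigma$-algebra generated by the sets $I_n(x)$, $x\in G_m$. A martingale is a sequence $f=(f^{(n)}:n\in\mathbb{N})$ of integrable functions with $f^{(n)}$ $\mathcal F_n$-measurable and $S_{M_n}f^{(l)}=f^{(n)}$ for $n\le l$. $f^*=\sup_n|f^{(n)}|$; $H_p$ ($0<p<\infty$) is the space of martingales with $\|f\|_{H_p}:=\|f^*\|_p<\infty$. For a martingale, $\widehat f(i)=\lim_{k\to\infty}\int_{G_m}f^{(k)}\overline{\psi_i}\,d\mu$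 and $S_nf=\sum_{k=0}^{n-1}\widehat f(k)\psi_k$. $T$ means: $T_nf=\frac1{Q_n}\sum_{k=0}^{n-1}q_kS_kf$ with $Q_n=\sum_{k=0}^{n-1}q_k$. *)

(* Defs.v *)
From HB Require Import structures.
From mathcomp Require Import all_boot all_order all_algebra.
From mathcomp Require Import complex.
From mathcomp Require Import all_classical all_reals all_analysis.

Set Implicit Arguments.
Unset Strict Implicit.
Unset Printing Implicit Defensive.

Import Order.TTheory GRing.Theory Num.Theory.
Import numFieldNormedType.Exports.

Local Open Scope classical_set_scope.
Local Open Scope complex_scope.
Local Open Scope ring_scope.

(* Caveat: ['Z_n] is the ring of integers mod [n] only for [1 < n]; the
   group below is the Vilenkin group only when [2 <= m k] for all [k]. *)
Definition discrete_Z (n : nat) := discrete_topology 'Z_n.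
HB.instance Definition _ (n : nat) := DiscreteTopology.on (discrete_Z n).
HB.instance Definition _ (n : nat) := isPointed.Build (discrete_Z n) (0 : 'Z_n).

Definition vilenkin_top (m : nat -> nat) : Type :=
  prod_topology (fun k => discrete_Z (m k)).
HB.instance Definition _ (m : nat -> nat) := Topological.on (vilenkin_top m).
HB.instance Definition _ (m : nat -> nat) := Pointed.on (vilenkin_top m).

(* G_m as a measurable space: its measurable sets are the Borel sets of the
   product topology. *)
Definition vilenkin (m : nat -> nat) :=
  g_sigma_algebraType (@open (vilenkin_top m)).

HB.instance Definition _ (m : nat -> nat) := Measurable.on (vilenkin m).

Section Vilenkin.
Variable m : nat -> nat.
Local Notation G := (vilenkin m).

Definition vadd (x y : G) : G := fun k => (x k : 'Z_(m k)) + y k.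

Definition cylinder (n : nat) (x : G) : set G :=
  [set y : G | forall k, (k < n)%N -> y k = x k].

Definition cylinder_sigma (n : nat) := g_sigma_algebraType (range (cylinder n)).

Definition bigM (n : nat) : nat := (\prod_(k < n) m k)%N.

(* The j-th digit n_j of n in the mixed-radix expansion n = sum_j n_j M_j. *)
Definition digit (n j : nat) : nat := ((n %/ bigM j) %% m j)%N.

Variable R : realType.
Variable mu : probability G R.

(* Translation invariance; normalization comes from [mu] being a probability. *)
Definition is_haar :=
  forall (a : G) (A : set G), measurable A -> mu (vadd a @` A) = mu A.

Definition rademacher (k : nat) (x : G) : R[i] :=
  let t := 2 * pi * (x k : nat)%:R / (m k)%:R in cos t +i* sin t.

(* As m_k >= 2, all digits n_k with k >= n vanish, so the product over all k
   reduces to the product over k < n. *)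
Definition psi (n : nat) (x : G) : R[i] :=
  \prod_(k < n) rademacher k x ^+ digit n k.

Definition cintegrable (g : G -> R[i]) :=
  mu.-integrable setT (fun x => (complex.Re (g x))%:E) /\
  mu.-integrable setT (fun x => (complex.Im (g x))%:E).

Definition cintegral (g : G -> R[i]) : R[i] :=
  (\int[mu]_x complex.Re (g x)) +i* (\int[mu]_x complex.Im (g x)).

Definition cylinder_measurable (n : nat) (g : G -> R[i]) :=
  measurable_fun setT
    ((fun x => complex.Re (g x)) : cylinder_sigma n -> R) /\
  measurable_fun setT
    ((fun x => complex.Im (g x)) : cylinder_sigma n -> R).

Definition fourier_coef (g : G -> R[i]) (n : nat) : R[i] :=
  cintegral (fun x => g x * (psi n x)^*).

(* S_n built from a sequence of Fourier coefficients, so that it applies both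
   to integrable functions and to martingales. *)
Definition partial_sum (c : nat -> R[i]) (n : nat) (x : G) : R[i] :=
  \sum_(k < n) c k * psi k x.

Definition is_martingale (f : nat -> G -> R[i]) :=
  [/\ forall n, cintegrable (f n),
      forall n, cylinder_measurable n (f n) &
      forall n l, (n <= l)%N ->
        partial_sum (fourier_coef (f l)) (bigM n) = f n].

Definition mart_coef (f : nat -> G -> R[i]) (i : nat) : R[i] :=
  lim ((fun k => (fourier_coef (f k) i : R[i]^o)) @ \oo).

Definition mart_partial_sum (f : nat -> G -> R[i]) (n : nat) : G -> R[i] :=
  partial_sum (mart_coef f) n.

Definition maximal_fun (f : nat -> G -> R[i]) (x : G) : \bar R :=
  ereal_sup (range (fun n => (ComplexField.Normc.normc (f n x))%:E)).

Definition Hp_norm (p : R) (f : nat -> G -> R[i]) : \bar R :=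
  Lnorm mu p%:E (maximal_fun f).

Definition Hp (p : R) : set (nat -> G -> R[i]) :=
  [set f | is_martingale f /\ (Hp_norm p f < +oo)%E].

Definition Lp_norm (p : R) (g : G -> R[i]) : \bar R :=
  Lnorm mu p%:E (fun x => (ComplexField.Normc.normc (g x))%:E).

Definition Qsum (q : nat -> R) (n : nat) : R := \sum_(k < n) q k.

Definition T_mean (q : nat -> R) (n : nat) (f : nat -> G -> R[i]) (x : G) :
    R[i] :=
  ((Qsum q n)^-1)%:C * \sum_(k < n) (q k)%:C * mart_partial_sum f k x.

End Vilenkin.

(* Main.v *)
(** Each [T_n f] with [n <= M_L] depends only on the level-[L] term of the
    martingale, and integrals of functions of the first [L] coordinates are
    finite averages, so it suffices to bound the partial sums of the series by
    the truncated maximal function, uniformly in [L].  Summation by parts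
    writes [Q_n T_n] as a combination, with nonnegative weights, of the sums
    [Phi_j = D_0 + ... + D_(j-1)] of Dirichlet kernels.  The recursion
    [D_(a M_s + i) = (1 + ... + rho^(a-1)) D_(M_s) + rho^a D_i] bounds [|Phi_j|]
    by sums of [M_k M_s] times the indicator that all coordinates below [s],
    except possibly the [k]-th, agree.  Cutting the martingale at the times it
    exceeds [c 2^k] gives atoms supported on cylinders [I_N] and orthogonal to
    [psi_j] for [j < M_N]; for these, [T_n] vanishes when [n <= M_N] and is
    controlled off the support by the kernel bound.  Summing over [n] gives a
    geometric series for [p < 1/2] and a logarithm for [p = 1/2]; the
    [p]-th powers then add up over the atoms. *)

From HB Require Import structures.
Require Import Defs.
From mathcomp Require Import all_boot all_order all_algebra.
From mathcomp Require Import complex ring lra zify.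
From mathcomp Require Import all_classical all_reals all_analysis measurable_realfun.

Set Implicit Arguments.
Unset Strict Implicit.
Unset Printing Implicit Defensive.

Import Order.TTheory GRing.Theory Num.Theory.
Import numFieldNormedType.Exports.

Local Open Scope classical_set_scope.
Local Open Scope complex_scope.
Local Open Scope ring_scope.

(** For [p < 1] the triangle inequality fails; [(a + b)^p <= a^p + b^p] replaces it, so that each
    atom of height [u] on a cylinder of level [N] can be treated alone and must cost [u^p / M_N].
    The critical exponent appears off the support: averaged over that cylinder, the kernel has
    height [M_k M_s / M_N] on a set of measure about [1 / M_s], whose [p]-th power integrates to
    [M_k^p M_s^(p-1) M_N^(-p)]. Summing over [k <= s] leaves [M_s^(2p-1)]: a convergent series over
    [s] for [p < 1/2], one unit per level for [p = 1/2]. Off the support, [q] enters only through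
    [q (M_N) / Q_n]. Monotonicity bounds this ratio by [1 / M_N], which makes [c_p] independent of
    [q]. For [p = 1/2] that bound would leave [N] times a further logarithm; the growth of [Q_n]
    improves it to a multiple of [1 / n]. Boundedness of [m] is used for the kernel constants and
    for the stopping argument, where stopping one level ahead must not enlarge the stopped set by
    more than a fixed factor. *)

Local Notation normc := ComplexField.Normc.normc.

(** * Powers, geometric sums, tails of series and a discrete layer-cake bound *)

Section RealLemmas.
Variable R : realType.
Implicit Types (a b p r x y : R).

(** The fractions [a / (a + b)] and [b / (a + b)] lie in [0, 1], where [t <= t^p], and they add up
    to 1. *)
Lemma powR_subadditive p a b : 0 < p <= 1 -> 0 <= a -> 0 <= b ->
  (a + b) `^ p <= a `^ p + b `^ p.
Proof.
case/andP=> p0 p1 a0 b0.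
have [s0|s0] := eqVneq (a + b) 0.
  by rewrite s0 powR0 ?gt_eqF // addr_ge0 ?powR_ge0.
have s_gt0 : 0 < a + b by rewrite lt_def s0 addr_ge0.
have H c : 0 <= c -> c <= a + b -> c / (a + b) * (a + b) `^ p <= c `^ p.
  move=> c0 cs.
  have -> : c `^ p = (c / (a + b)) `^ p * (a + b) `^ p.
    by rewrite -powRM ?divfK // ?divr_ge0 // ltW.
  rewrite ler_wpM2r ?powR_ge0 //.
  have [->|cn0] := eqVneq c 0; first by rewrite mul0r powR_ge0.
  have cs0 : 0 < c / (a + b) by rewrite divr_gt0 // lt_def cn0.
  rewrite -[leLHS](powRr1 (ltW cs0)).
  by rewrite ger_powR // cs0 ler_pdivrMr // mul1r.
have := lerD (H a a0 _) (H b b0 _); rewrite lerDl lerDr => /(_ b0 a0).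
by rewrite -mulrDl -mulrDl divff // mul1r.
Qed.

Lemma powR2_gt1 p : 0 < p -> 1 < 2 `^ p :> R.
Proof.
by move=> p0; rewrite /powR pnatr_eq0 expR_gt1 mulr_gt0 // ln_gt0 // ltr1n.
Qed.

Lemma powR_sum_le (I : Type) (s : seq I) (P : pred I) (F : I -> R) p :
  0 < p <= 1 -> (forall i, P i -> 0 <= F i) ->
  (\sum_(i <- s | P i) F i) `^ p <= \sum_(i <- s | P i) F i `^ p.
Proof.
move=> hp F0; have p0 : p != 0 by case/andP: hp => /gt_eqF ->.
elim: s => [|i s IH]; first by rewrite !big_nil powR0.
rewrite !big_cons; case: ifP => // Pi.
apply: (le_trans (powR_subadditive hp (F0 _ Pi) _)); first exact: sumr_ge0.
by rewrite lerD2l.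
Qed.

(** Meant for [M k] and its [p]-th power, which grow at each level by at least 2 and [2^p]: a sum
    over levels then costs no more than its last term. *)
Lemma sum_geom_increasing (a : nat -> R) b :
  1 < b -> (forall k, 0 <= a k) -> (forall k, b * a k <= a k.+1) ->
  forall n, \sum_(k < n.+1) a k <= b / (b - 1) * a n.
Proof.
move=> b1 a0 ha; have b10 : 0 < b - 1 by rewrite subr_gt0.
have E : b / (b - 1) = 1 + (b - 1)^-1 by field; rewrite gt_eqF.
elim=> [|n IH].
  by rewrite big_ord_recl big_ord0 addr0 ler_peMl // E lerDl invr_ge0 ltW.
rewrite big_ord_recr /= E mulrDl mul1r addrC lerD2l.
apply: (le_trans IH); rewrite mulrAC mulrC ler_wpM2l ?invr_ge0 ?(ltW b10) //.
Qed.

Lemma sum_geom_decreasing (a : nat -> R) b :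
  1 < b -> (forall k, 0 <= a k) -> (forall k, b * a k.+1 <= a k) ->
  forall n, \sum_(k < n) a k <= b / (b - 1) * a 0%N.
Proof.
move=> b1 a0 ha n; have b10 : 0 < b - 1 by rewrite subr_gt0.
have c0 : 0 <= b / (b - 1) by rewrite divr_ge0 ?(ltW b10) // ltW // (lt_trans _ b1).
(* The added term pays for the next summand: [C = b / (b - 1)] satisfies [C = 1 + C / b], hence
   [a n + C * a n.+1 <= C * a n]. *)
suff h: \sum_(k < n) a k + b / (b - 1) * a n <= b / (b - 1) * a 0%N.
  by apply: le_trans h; rewrite lerDl mulr_ge0.
elim: n => [|n IH]; first by rewrite big_ord0 add0r.
apply: le_trans IH; rewrite big_ord_recr /= -addrA lerD2l.
have E : b / (b - 1) = 1 + (b - 1)^-1 by field; rewrite gt_eqF.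
rewrite [leRHS](congr1 (fun c => c * a n) E) mulrDl mul1r lerD2l mulrAC mulrC.
by rewrite ler_wpM2l ?invr_ge0 ?(ltW b10).
Qed.

(** Discrete comparison of [x^(-1-r)] with its primitive. It amounts to
    [(1 - 1/(n+1))^(-r) >= 1 + r/(n+1)], which follows from [ln (1 - x) <= -x] and
    [exp y >= 1 + y]. *)
Lemma tail_term r n : 0 < r -> (0 < n)%N ->
  n.+1%:R `^ (- (1 + r)) <= r^-1 * (n%:R `^ (- r) - n.+1%:R `^ (- r) : R).
Proof.
move=> r0 n0; rewrite ler_pdivlMl //.
have n1 : (0 : R) < n.+1%:R by rewrite ltr0n.
have nn : (0 : R) < n%:R by rewrite ltr0n.
rewrite opprD powRD ?pnatr_eq0 ?implybT // powR_inv1 ?(ltW n1) //.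
have -> : n%:R `^ (- r) = n.+1%:R `^ (- r) * (n%:R / n.+1%:R) `^ (- r) :> R.
  rewrite -powRM ?divr_ge0 ?(ltW n1) ?(ltW nn) //; congr (_ `^ _); field.
  by rewrite addrC natr1 gt_eqF.
have: 1 + r / n.+1%:R <= (n%:R / n.+1%:R) `^ (- r) :> R.
  rewrite /powR gt_eqF ?divr_gt0 //.
  apply: le_trans (expR_ge1Dx _); rewrite lerD2l.
  have : ln (n%:R / n.+1%:R) <= - n.+1%:R^-1 :> R.
    have -> : n%:R / n.+1%:R = 1 + (- n.+1%:R^-1) :> R.
      by rewrite -natr1; field; rewrite natr1 gt_eqF.
    apply: le_ln1Dx.
    by rewrite ltrNl opprK invf_lt1 // ltr1n ltnS.
  by move=> h; rewrite mulNr -mulrN ler_wpM2l ?(ltW r0) // lerNr.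
set z := (_ / _) `^ _; set w := _ `^ (- r); have w0 : 0 <= w by exact: powR_ge0.
by move=> /(ler_wpM2l w0); rewrite mulrDr mulr1 -lerBrDl; move: (n.+1%:R^-1) => i; lra.
Qed.

Lemma tail_sum r M K : 0 < r -> (0 < M)%N -> (M <= K)%N ->
  \sum_(M <= n < K) n.+1%:R `^ (- (1 + r)) <= r^-1 * M%:R `^ (- r) :> R.
Proof.
move=> r0 M0 MK.
suff: \sum_(M <= n < K) n.+1%:R `^ (- (1 + r))
    <= r^-1 * (M%:R `^ (- r) - K%:R `^ (- r)) :> R.
  move=> /le_trans; apply; rewrite ler_wpM2l ?invr_ge0 ?(ltW r0) //.
  by rewrite gerBl powR_ge0.
elim: K MK => [|K IH]; first by rewrite leqn0 => /eqP M0'; rewrite M0' in M0.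
rewrite leq_eqVlt => /predU1P[<-|]; first by rewrite big_geq // subrr mulr0.
rewrite ltnS => MK; rewrite big_nat_recr //=.
apply: (le_trans (lerD (IH MK) (tail_term r0 (leq_trans M0 MK)))).
by rewrite -mulrDr addrA subrK.
Qed.

Lemma harmonic_le_ln n : (0 < n)%N ->
  \sum_(1 <= k < n.+1) (k%:R^-1 : R) <= 1 + ln n%:R.
Proof.
elim: n => // -[|n] IH _; first by rewrite big_nat1 invr1 ln1 addr0.
rewrite big_nat_recr //=; apply: (le_trans (lerD (IH isT) (lexx _))).
rewrite -addrA lerD2l.
have h0 : (0 : R) < n.+1%:R by rewrite ltr0n.
have h1 : (0 : R) < n.+2%:R by rewrite ltr0n.
have -> : n.+1%:R = n.+2%:R * (1 + - n.+2%:R^-1) :> R.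
  by rewrite mulrDr mulr1 mulrN divff ?gt_eqF // -[n.+2%:R]natr1 addrK.
have hh : -1 < - n.+2%:R^-1 :> R by rewrite ltrNl opprK invf_lt1 // ltr1n.
rewrite lnM ?posrE //; last first.
  by rewrite -ltrBlDl sub0r.
by rewrite -addrA gerDl -lerBrDr sub0r le_ln1Dx.
Qed.

(** From [y^r = exp (r ln y) >= 1 + u r ln 2]. With [y = n / M_N] it absorbs the number of levels
    between [M_N] and [n] into an arbitrarily small power. *)
Lemma succ_le_powR r u y : 0 < r -> 2 ^+ u <= y ->
  u.+1%:R <= (1 + (r * ln 2)^-1) * y `^ r.
Proof.
move=> r0 uy; have l2 : 0 < ln 2 :> R by rewrite ln_gt0 // ltr1n.
have y0 : 0 < y by apply: lt_le_trans uy; rewrite exprn_gt0.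
have h : 1 + u%:R * (r * ln 2) <= y `^ r.
  rewrite /powR gt_eqF //; apply: le_trans (expR_ge1Dx _); rewrite lerD2l.
  rewrite mulrCA ler_wpM2l ?(ltW r0) // mulr_natl -lnXn // ler_ln ?posrE //.
have c0 : 0 < r * ln 2 by rewrite mulr_gt0.
apply: le_trans (ler_wpM2l _ h); last by rewrite addr_ge0 // invr_ge0 ltW.
rewrite mulrDl mul1r mulrDr mulr1.
have -> : (r * ln 2)^-1 * (u%:R * (r * ln 2)) = u%:R.
  by field; rewrite !gt_eqF.
rewrite -natr1; have := mulr_ge0 (ler0n R u) (ltW c0).
have : 0 < (r * ln 2)^-1 by rewrite invr_gt0.
lra.
Qed.

Lemma layer_sum_le p t y K : 0 < p -> 0 < t -> 0 <= y ->
  \sum_(k < K) (t * 2 ^+ k) `^ p * (t * 2 ^+ k < y)%R%:R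
    <= 2 `^ p / (2 `^ p - 1) * y `^ p.
Proof.
move=> p0 t0 y0; set b := 2 `^ p.
have b1 : 1 < b by exact: powR2_gt1.
have b10 : 0 < b - 1 by rewrite subr_gt0.
have b0 : 0 < b by rewrite (lt_trans _ b1).
have tp k : 0 < t * 2 ^+ k by rewrite mulr_gt0 // exprn_gt0.
have tS k : (t * 2 ^+ k.+1) `^ p = b * (t * 2 ^+ k) `^ p.
  by rewrite exprS mulrCA powRM // ltW.
(* The second bound, free of [y], drives the induction while the thresholds lie below [y]; beyond
   [y] the sum no longer grows and the first bound persists. *)
suff [] : (\sum_(k < K) (t * 2 ^+ k) `^ p * (t * 2 ^+ k < y)%R%:R
             <= b / (b - 1) * y `^ p) /\
   (\sum_(k < K) (t * 2 ^+ k) `^ p * (t * 2 ^+ k < y)%R%:R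
             <= (b - 1)^-1 * (t * 2 ^+ K) `^ p) by [].
elim: K => [|K [IH1 IH2]].
  by rewrite big_ord0 !mulr_ge0 ?invr_ge0 ?powR_ge0 ?(ltW b0) ?(ltW b10).
rewrite !big_ord_recr /= tS.
have h2 : (t * 2 ^+ K) `^ p * (t * 2 ^+ K < y)%R%:R <= (t * 2 ^+ K) `^ p.
  by rewrite ler_piMr ?powR_ge0 //; case: (_ < _).
have E : (b - 1)^-1 * (b * (t * 2 ^+ K) `^ p)
   = (b - 1)^-1 * (t * 2 ^+ K) `^ p + (t * 2 ^+ K) `^ p.
  by field; rewrite gt_eqF.
have h3 := lerD IH2 h2.
split; last by rewrite E.
case: ltP => hy; last by rewrite mulr0 addr0.
apply: (le_trans (lerD IH2 (lexx _))).
rewrite mulr1 -E -mulrA mulrCA ler_wpM2l ?(ltW b0) //.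
rewrite ler_wpM2l ?invr_ge0 ?(ltW b10) //.
by rewrite ge0_ler_powR ?nnegrE ?(ltW p0) ?(ltW hy) // ltW.
Qed.

End RealLemmas.

(** * Mixed-radix points and finite averages *)

Section Digits.
Variable m : nat -> nat.
Hypothesis m_ge2 : forall k, (2 <= m k)%N.
Local Notation M := (bigM m).

Lemma m_gt0 k : (0 < m k)%N. Proof. exact: leq_trans (m_ge2 k). Qed.

Lemma bigM0 : M 0 = 1%N. Proof. by rewrite /bigM big_ord0. Qed.

Lemma bigMS n : M n.+1 = (m n * M n)%N.
Proof. by rewrite /bigM big_ord_recr /= mulnC. Qed.

Lemma bigM_gt0 n : (0 < M n)%N.
Proof. by rewrite prodn_gt0 // => k; exact: m_gt0. Qed.

Lemma bigM_dvd n k : (n <= k)%N -> (M n %| M k)%N.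
Proof.
elim: k => [|k IH]; first by rewrite leqn0 => /eqP ->.
rewrite leq_eqVlt => /predU1P[->//|]; rewrite ltnS => /IH.
by rewrite bigMS; exact: dvdn_mull.
Qed.

Lemma leq_bigM n k : (n <= k)%N -> (M n <= M k)%N.
Proof. by move=> /bigM_dvd; apply: dvdn_leq; exact: bigM_gt0. Qed.

Lemma leq_double_bigM n : (2 * M n <= M n.+1)%N.
Proof. by rewrite bigMS leq_mul2r m_ge2 orbT. Qed.

Lemma expn2_bigM n : (2 ^ n <= M n)%N.
Proof.
elim: n => [|n IH]; first by rewrite bigM0.
by rewrite expnS (leq_trans _ (leq_double_bigM n)) // leq_mul2l IH orbT.
Qed.

Lemma ltn_bigM n : (n < M n)%N.
Proof. by rewrite (leq_trans _ (expn2_bigM n)) // ltn_expl. Qed.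

Lemma digit_lt n j : (digit m n j < m j)%N.
Proof. by rewrite ltn_mod m_gt0. Qed.

Lemma digit_big n j : (n < M j)%N -> digit m n j = 0%N.
Proof. by move=> h; rewrite /digit divn_small // mod0n. Qed.

Lemma digitD_lt N a r j : (j < N)%N -> digit m (a * M N + r) j = digit m r j.
Proof.
move=> /bigM_dvd /dvdnP[c ->]; rewrite bigMS /digit.
rewrite (_ : a * (c * (m j * M j)) = a * c * m j * M j)%N; last by ring.
by rewrite divnMDl ?bigM_gt0 // modnMDl.
Qed.

Lemma digitD_eq N a r : (a < m N)%N -> (r < M N)%N ->
  digit m (a * M N + r) N = a.
Proof.
by move=> am rM; rewrite /digit divnMDl ?bigM_gt0 // divn_small // addn0 modn_small.
Qed.

Lemma mixed_radix_lt N a r : (a < m N)%N -> (r < M N)%N -> (a * M N + r < M N.+1)%N.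
Proof.
move=> am rM; rewrite bigMS; apply: leq_trans (_ : a.+1 * M N <= _)%N.
  by rewrite mulSn addnC ltn_add2r.
by rewrite leq_mul2r am orbT.
Qed.

Lemma mixed_radix N n : (n < M N.+1)%N ->
  exists a r, [/\ (a < m N)%N, (r < M N)%N & n = (a * M N + r)%N].
Proof.
move=> h; exists (n %/ M N)%N, (n %% M N)%N; split.
- by rewrite ltn_divLR ?bigM_gt0 // -bigMS.
- by rewrite ltn_mod bigM_gt0.
- exact: divn_eq.
Qed.

Lemma sum_mulnD (V : nmodType) (n k : nat) (F : nat -> V) :
  \sum_(i < n * k) F i = \sum_(a < n) \sum_(r < k) F (a * k + r)%N.
Proof.
elim: n => [|n IH]; first by rewrite mul0n !big_ord0.
rewrite big_ord_recr /= -IH -(big_mkord predT) mulSn addnC.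
rewrite (big_cat_nat (n := n * k)) ?leq_addr //= big_mkord; congr (_ + _).
by rewrite -{1}[(n * k)%N]add0n big_addn addKn big_mkord; apply: eq_bigr => i _; rewrite addnC.
Qed.

Lemma sum_bigMS (V : nmodType) N (F : nat -> V) :
  \sum_(i < M N.+1) F i = \sum_(a < m N) \sum_(r < M N) F (a * M N + r)%N.
Proof. by rewrite bigMS sum_mulnD. Qed.

Local Notation X := (vilenkin m).

Definition agree n (x y : X) : bool :=
  [forall k : 'I_n, (x k : 'Z_(m k)) == (y k : 'Z_(m k))].

Lemma agreeP n x y : reflect (forall k, (k < n)%N -> x k = y k) (agree n x y).
Proof.
apply: (iffP forallP) => [h k kn|h k]; first exact: (eqP (h (Ordinal kn))).
by apply/eqP; exact: h.
Qed.

Lemma agree_refl n x : agree n x x. Proof. exact/agreeP. Qed.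

Lemma agree_sym n x y : agree n x y = agree n y x.
Proof. by apply/agreeP/agreeP => h k /h. Qed.

Lemma agree_trans n x y z : agree n x y -> agree n y z -> agree n x z.
Proof. by move=> /agreeP h /agreeP h'; apply/agreeP => k kn; rewrite h ?h'. Qed.

Lemma agreeW n k x y : (n <= k)%N -> agree k x y -> agree n x y.
Proof. by move=> nk /agreeP h; apply/agreeP => j jn; rewrite h ?(leq_trans jn). Qed.

Lemma agreeS n x y : agree n.+1 x y = agree n x y && ((x n : 'Z_(m n)) == y n).
Proof.
apply/agreeP/andP => [h|[/agreeP h /eqP h'] k].
  by split; [apply/agreeP => k kn; apply: h; rewrite ltnW|apply/eqP; exact: h].
by rewrite ltnS leq_eqVlt => /predU1P[->//|]; exact: h.
Qed.

Lemma agree_congr n x y z : agree n x y -> agree n x z = agree n y z.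
Proof.
move=> h; apply/idP/idP; last exact: agree_trans.
by apply: agree_trans; rewrite agree_sym.
Qed.

(* For [i < M n] these points represent the cylinders of level [n], one each. *)
Definition pt (i : nat) : X := fun k => inZp (digit m i k) : 'Z_(m k).

Lemma Zp_truncK k : (Zp_trunc (m k)).+2 = m k.
Proof. by rewrite Zp_cast // m_ge2. Qed.

Lemma ptE i k : (pt i k : 'Z_(m k)) = digit m i k :> nat.
Proof. by rewrite /= Zp_truncK modn_small // digit_lt. Qed.

Lemma coord_lt (x : X) k : ((x k : 'Z_(m k)) < m k)%N.
Proof. by rewrite -[X in (_ < X)%N]Zp_truncK; exact: ltn_ord. Qed.

Lemma pt_agree_ex N x : exists2 i, (i < M N)%N & agree N (pt i) x.
Proof.
elim: N => [|N [i iM ix]].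
  by exists 0%N; [rewrite bigM0|apply/agreeP].
exists ((x N : 'Z_(m N)) * M N + i)%N; first exact: mixed_radix_lt (coord_lt _ _) iM.
rewrite agreeS; apply/andP; split; last first.
  by apply/eqP/ord_inj/(etrans (ptE _ _)); rewrite digitD_eq ?coord_lt.
apply/agreeP => k kN; move/agreeP : ix => /(_ k kN) <-.
by apply/ord_inj/(etrans (ptE _ _)); rewrite digitD_lt // -ptE.
Qed.

Lemma agree_pt_digit N i j : agree N (pt i) (pt j) ->
  forall k, (k < N)%N -> digit m i k = digit m j k.
Proof.
by move=> /agreeP h k /h e; rewrite -!ptE; congr (nat_of_ord _).
Qed.

Lemma pt_agree_inj N i j : (i < M N)%N -> (j < M N)%N ->
  agree N (pt i) (pt j) -> i = j.
Proof.
move=> iM jM /agree_pt_digit.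
elim: N i j iM jM => [|N IH] i j; first by rewrite bigM0 !ltnS !leqn0 => /eqP-> /eqP->.
move=> /mixed_radix[a [r [am rM ->]]] /mixed_radix[b [s [bm sM ->]]] h.
have := h N (leqnn _); rewrite !digitD_eq // => ->; congr (_ + _)%N.
by apply: IH => // k kN; have := h k (ltnW kN); rewrite !digitD_lt.
Qed.

Lemma sum_agree (V : pzSemiRingType) N x :
  \sum_(i < M N) (agree N (pt i) x)%:R = 1 :> V.
Proof.
have [i iM ix] := pt_agree_ex N x.
rewrite (bigD1 (Ordinal iM)) //= ix big1 ?addr0 // => j jn.
case: (boolP (agree N (pt j) x)) => // jx; case/eqP: jn; apply/val_inj => /=.
apply: (pt_agree_inj (ltn_ord j) iM); rewrite agree_sym in ix.
exact: agree_trans jx ix.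
Qed.

Lemma agree_pt_mixed s L a r z : (s <= L)%N ->
  agree s z (pt (a * M L + r)) = agree s z (pt r).
Proof.
move=> sL; rewrite agree_sym [RHS]agree_sym; apply: agree_congr; apply/agreeP => k ks.
by apply/ord_inj/(etrans (ptE _ _)); rewrite digitD_lt ?(leq_trans ks) // -ptE.
Qed.

(** One more level repeats the sample points [m_L] times without touching the coordinates below [L],
    so their proportion in a cylinder of level [s] stays [1 / M_s]. *)
Lemma sum_cylinder (V : pzSemiRingType) s L z : (s <= L)%N ->
  (M s)%:R * \sum_(i < M L) (agree s z (pt i))%:R = (M L)%:R :> V.
Proof.
elim: L => [|L IH].
  rewrite leqn0 => /eqP->; rewrite bigM0 big_ord_recl big_ord0 mul1r addr0.
  by have -> : agree 0 z (pt (@ord0 0)) by apply/agreeP.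
rewrite leq_eqVlt => /predU1P[->|].
  by under eq_bigr do rewrite agree_sym; rewrite sum_agree mulr1.
rewrite ltnS => sL; rewrite (sum_bigMS L (fun i => (agree s z (pt i))%:R)).
under eq_bigr => a _ do under eq_bigr => r _ do rewrite agree_pt_mixed //.
by rewrite sumr_const card_ord mulrnAr IH // bigMS natrM mulr_natl.
Qed.

End Digits.

Section Average.
Variable m : nat -> nat.
Hypothesis m_ge2 : forall k, (2 <= m k)%N.
Local Notation M := (bigM m).
Local Notation X := (vilenkin m).

Definition level (T : Type) n (g : X -> T) := forall x y, agree n x y -> g x = g y.

Lemma levelW (T : Type) n k (g : X -> T) : (n <= k)%N -> level n g -> level k g.
Proof. by move=> nk h x y /(agreeW nk)/h. Qed.

Section AverageField.
Variable V : numFieldType.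
Implicit Types g h : X -> V.

(* The integral of any [g] depending only on the first [L] coordinates. *)
Definition av L g : V := (M L)%:R^-1 * \sum_(i < M L) g (pt m i).

Lemma natM_gt0 n : 0 < (M n)%:R :> V.
Proof. by rewrite ltr0n bigM_gt0. Qed.

Lemma natM_neq0 n : (M n)%:R != 0 :> V.
Proof. by rewrite gt_eqF ?natM_gt0. Qed.

Lemma avD L g h : av L (fun x => g x + h x) = av L g + av L h.
Proof. by rewrite /av big_split mulrDr. Qed.

Lemma avZ L c g : av L (fun x => c * g x) = c * av L g.
Proof. by rewrite /av -mulr_sumr mulrCA. Qed.

Lemma avN L g : av L (fun x => - g x) = - av L g.
Proof. by rewrite /av sumrN mulrN. Qed.

Lemma avB L g h : av L (fun x => g x - h x) = av L g - av L h.
Proof. by rewrite avD avN. Qed.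

Lemma av_sum (I : Type) (s : seq I) (P : pred I) (F : I -> X -> V) L :
  av L (fun x => \sum_(i <- s | P i) F i x) = \sum_(i <- s | P i) av L (F i).
Proof. by rewrite /av exchange_big -mulr_sumr. Qed.

Lemma eq_av L g h : g =1 h -> av L g = av L h.
Proof. by move=> gh; rewrite /av; congr (_ * _); apply: eq_bigr => i _. Qed.

Lemma av_le L g h : (forall x, g x <= h x) -> av L g <= av L h.
Proof. by move=> gh; rewrite /av ler_pM2l ?invr_gt0 ?natM_gt0 // ler_sum. Qed.

Lemma av_ge0 L g : (forall x, 0 <= g x) -> 0 <= av L g.
Proof. by move=> gh; rewrite /av mulr_ge0 ?invr_ge0 ?(ltW (natM_gt0 _)) ?sumr_ge0. Qed.

Lemma av_cst L c : av L (fun=> c) = c.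
Proof.
by rewrite /av sumr_const card_ord -[c *+ _]mulr_natl mulKf // natM_neq0.
Qed.

Lemma av_cyl s L z : (s <= L)%N ->
  av L (fun t => (agree s z t)%:R) = (M s)%:R^-1.
Proof.
move=> sL; rewrite /av; apply: (mulfI (natM_neq0 s)); apply: (mulfI (natM_neq0 L)).
rewrite mulrCA mulVKf ?natM_neq0 // sum_cylinder // divff ?natM_neq0 //.
by rewrite mulr1.
Qed.

Lemma level_sum N g x : level N g ->
  g x = \sum_(j < M N) g (pt m j) * (agree N (pt m j) x)%:R.
Proof.
move=> gN; rewrite -[g x in LHS]mulr1 -[1 in LHS](sum_agree m_ge2 V N x) mulr_sumr.
apply: eq_bigr => j _; case: (boolP (agree N (pt m j) x)) => h; last by rewrite !mulr0.
by rewrite (gN _ _ h).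
Qed.

(** A cylinder of level [N] has mass [1 / M_N] at every finer level. Averages at different levels
    therefore behave as one integral. *)
Lemma av_level N L g : (N <= L)%N -> level N g -> av L g = av N g.
Proof.
move=> NL gN; rewrite (eq_av L (fun x => level_sum x gN)) av_sum.
under eq_bigr do rewrite avZ av_cyl //.
by rewrite -mulr_suml mulrC.
Qed.

Lemma av_exchange L (F : X -> X -> V) :
  av L (fun x => av L (fun t => F x t)) = av L (fun t => av L (fun x => F x t)).
Proof.
rewrite /av; congr (_ * _); rewrite -!mulr_sumr; congr (_ * _).
exact: exchange_big.
Qed.

End AverageField.
End Average.

(** * Dirichlet and Fejer kernels *)

Section ComplexNorm.
Variable R : realType.
Implicit Types z w : R[i].

Lemma normcD z w : normc (z + w) <= normc z + normc w.
Proof. exact: le_normcD. Qed.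

Lemma normc_ge0 z : 0 <= normc z.
Proof. by case: z => a b; exact: sqrtr_ge0. Qed.

Lemma normc_opp z : normc (- z) = normc z.
Proof. by case: z => a b; rewrite /= !sqrrN. Qed.

Lemma normc_sum (I : Type) (s : seq I) (P : pred I) (F : I -> R[i]) :
  normc (\sum_(i <- s | P i) F i) <= \sum_(i <- s | P i) normc (F i).
Proof.
elim/big_ind2 : _ => [|z1 a z2 b h1 h2|//].
  by rewrite ComplexField.Normc.normc0.
exact: le_trans (normcD _ _) (lerD h1 h2).
Qed.

Lemma normc_real (a : R) : normc a%:C = `|a|.
Proof. by rewrite /= expr0n addr0 sqrtr_sqr. Qed.

Lemma normc_nat n : normc (n%:R : R[i]) = n%:R.
Proof.
have -> : n%:R = (n%:R : R)%:C by rewrite rmorph_nat.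
by rewrite normc_real normr_nat.
Qed.

Lemma normcX z n : normc (z ^+ n) = normc z ^+ n.
Proof.
elim: n => [|n IH]; first by rewrite !expr0 ComplexField.Normc.normc1.
by rewrite !exprS ComplexField.Normc.normcM IH.
Qed.

Lemma normc_av (m : nat -> nat) (m_ge2 : forall k, (2 <= m k)%N) L
    (g : vilenkin m -> R[i]) :
  normc (av L g) <= av L (fun x => normc (g x)).
Proof.
rewrite /av ComplexField.Normc.normcM ComplexField.Normc.normcV normc_nat.
by rewrite ler_wpM2l ?invr_ge0 ?ler0n // normc_sum.
Qed.

Definition cis (t : R) : R[i] := cos t +i* sin t.

Lemma cisD s t : cis (s + t) = cis s * cis t.
Proof. by apply/eqP; rewrite /cis cosD sinD eq_complex /= !eqxx /= addrC mulrC [sin t * _]mulrC. Qed.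

Lemma cisN t : cis (- t) = (cis t)^*.
Proof. by rewrite /cis cosN sinN. Qed.

Lemma cis0 : cis 0 = 1.
Proof. by rewrite /cis cos0 sin0. Qed.

Lemma cisMn t n : cis (t *+ n) = cis t ^+ n.
Proof. by elim: n => [|n IH]; rewrite ?cis0 // mulrS cisD IH exprS. Qed.

Lemma normc_cis t : normc (cis t) = 1.
Proof. by rewrite /= cos2Dsin2 sqrtr1. Qed.

(** The real part is [1 - 2 sin^2 (t/2)], and [0 < t/2 < pi]. *)
Lemma cis_neq1 t : 0 < t < 2 * pi -> cis t != 1.
Proof.
move=> /andP[t0 t1]; rewrite eq_complex /= negb_and.
have s0 : 0 < sin (t / 2).
  by rewrite sin_gt0_pi // divr_gt0 //= ltr_pdivrMr // mulrC.
have := cosD (t / 2) (t / 2); rewrite -splitr => ->.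
rewrite -!expr2 cos2sin2 -addrA -opprD lt_eqF //.
by rewrite gtrBl addr_gt0 // exprn_gt0.
Qed.

Lemma cis2pi : cis (2 * pi) = 1.
Proof.
have -> : 2 * pi = pi *+ 2 :> R by rewrite mulr_natl.
by rewrite /cis cos2pi; congr (_ +i* _); rewrite mulr2n sinD sinpi mulr0 mul0r addr0.
Qed.

End ComplexNorm.

Section Kernels.
Variables (R : realType) (m : nat -> nat).
Hypothesis m_ge2 : forall k, (2 <= m k)%N.
Local Notation M := (bigM m).
Local Notation X := (vilenkin m).
Implicit Types x t : X.

Definition rho s x t : R[i] := rademacher R s x * (rademacher R s t)^*.

Definition psi_kernel n x t : R[i] := psi R n x * (psi R n t)^*.

Definition dirichlet n x t := \sum_(k < n) psi_kernel k x t.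

(* [n] times the Fejer kernel; the convention [D_0 = 0] matches the sum over
   [k < n] in [T_mean]. *)
Definition fejer_sum n x t := \sum_(k < n) dirichlet k x t.

(** The cut-off [n] in [psi] may be exchanged for any [N] with [n < M N], since the further digits
    vanish. Block decompositions of [n] need the cut-off at a level. *)
Lemma psiE N n x : (n < M N)%N ->
  psi R n x = \prod_(j < N) rademacher R j x ^+ digit m n j.
Proof.
have P a b : (a <= b)%N -> (n < M a)%N ->
    \prod_(j < b) rademacher R j x ^+ digit m n j
    = \prod_(j < a) rademacher R j x ^+ digit m n j.
  move=> ab na.
  rewrite -!(big_mkord predT (fun j => rademacher R j x ^+ digit m n j)).
  rewrite (big_cat_nat (n := a)) //= [X in _ * X]big_nat_cond [X in _ * X]big1 ?mulr1 //.
  move=> j; rewrite andbT => /andP[aj _].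
  by rewrite digit_big // (leq_trans na) // leq_bigM.
move=> nN; have [nN'|/ltnW nN'] := leqP n N; last exact: P.
by rewrite [RHS](P n) // ltn_bigM.
Qed.

Lemma psi_level N n : (n < M N)%N -> level N (psi R n : X -> R[i]).
Proof.
move=> nN x y xy; rewrite !(psiE _ nN); apply: eq_bigr => j _.
by congr (_ ^+ _); rewrite /rademacher; move/agreeP: xy => ->.
Qed.

Lemma psi_kernelE N n x t : (n < M N)%N ->
  psi_kernel n x t = \prod_(j < N) rho j x t ^+ digit m n j.
Proof.
move=> nN; rewrite /psi_kernel !(psiE _ nN) rmorph_prod -big_split.
by apply: eq_bigr => j _ /=; rewrite rmorphXn -exprMn.
Qed.

Lemma psi_kernel_mixed s a i x t : (a < m s)%N -> (i < M s)%N ->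
  psi_kernel (a * M s + i) x t = rho s x t ^+ a * psi_kernel i x t.
Proof.
move=> am iM; rewrite (psi_kernelE _ _ (mixed_radix_lt am iM)).
rewrite (psi_kernelE _ _ iM) big_ord_recr /= digitD_eq // mulrC; congr (_ * _).
by apply: eq_bigr => j _; rewrite digitD_lt.
Qed.

Definition geom_rho s a x t := \sum_(b < a) rho s x t ^+ b.

Lemma dirichlet_mulM s a x t : (a <= m s)%N ->
  dirichlet (a * M s) x t = geom_rho s a x t * dirichlet (M s) x t.
Proof.
move=> am; rewrite /dirichlet (sum_mulnD a (M s) (fun k => psi_kernel k x t)).
rewrite mulr_suml; apply: eq_bigr => b _; rewrite mulr_sumr; apply: eq_bigr => r _.
by rewrite psi_kernel_mixed // (leq_trans _ am).
Qed.

Lemma dirichlet_mixed s a i x t : (a < m s)%N -> (i <= M s)%N ->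
  dirichlet (a * M s + i) x t =
  geom_rho s a x t * dirichlet (M s) x t + rho s x t ^+ a * dirichlet i x t.
Proof.
move=> am iM; rewrite {1}/dirichlet big_split_ord /= -/(dirichlet _ x t).
rewrite dirichlet_mulM ?(ltnW am) //; congr (_ + _); rewrite mulr_sumr.
by apply: eq_bigr => r _; rewrite psi_kernel_mixed // (leq_trans _ iM).
Qed.

Lemma rhoE s x t : rho s x t =
  cis (2 * pi * ((x s : 'Z_(m s))%:R - (t s : 'Z_(m s))%:R) / (m s)%:R).
Proof.
by rewrite mulrBr mulrBl cisD cisN.
Qed.

Lemma normc_rho s x t : normc (rho s x t) = 1.
Proof. by rewrite rhoE normc_cis. Qed.

Lemma rho_eq s x t : x s = t s -> rho s x t = 1.
Proof. by move=> xt; rewrite rhoE xt subrr mulr0 mul0r cis0. Qed.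

Lemma rho_neq1 s x t : (x s : 'Z_(m s)) != t s -> rho s x t != 1.
Proof.
have ms : 0 < (m s)%:R :> R by rewrite ltr0n m_gt0.
have pi0 : 0 < 2 * pi :> R by rewrite mulr_gt0 // pi_gt0.
(* For [u_s < v_s] the angle is a proper positive fraction of [2 pi]; the opposite order follows by
   conjugation. *)
have key (u v : X) : ((u s : 'Z_(m s)) < (v s : 'Z_(m s)))%N -> rho s v u != 1.
  move=> uv; rewrite rhoE cis_neq1 // -mulrA; apply/andP; split.
    by rewrite mulr_gt0 // divr_gt0 // subr_gt0 ltr_nat.
  rewrite gtr_pMr // ltr_pdivrMr // mul1r ltrBlDr -natrD ltr_nat.
  by rewrite ltn_addr // coord_lt.
rewrite -(inj_eq val_inj) neq_ltn => /orP[xt|]; last exact: key.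
apply: contraNneq (key _ _ xt) => h.
have -> : rho s t x = (rho s x t)^* by rewrite !rhoE -cisN -mulNr -mulrN opprB.
by rewrite h rmorph1.
Qed.

Lemma rho_expm s x t : rho s x t ^+ m s = 1.
Proof.
have ms : (m s)%:R != 0 :> R by rewrite pnatr_eq0 -lt0n m_gt0.
rewrite rhoE -cisMn -[_ *+ m s]mulr_natr divfK // mulrBr cisD cisN !mulr_natr !cisMn cis2pi.
by rewrite !expr1n rmorph1 mulr1.
Qed.

(** Orthogonality on one cyclic factor: [rho] is an [m_s]-th root of unity, so the full geometric
    sum vanishes unless [rho = 1], which means equal [s]-th coordinates. *)
Lemma geom_rho_full s x t :
  geom_rho s (m s) x t = (m s)%:R * ((x s : 'Z_(m s)) == t s)%:R.
Proof.
rewrite /geom_rho; have [xt|xt] := eqVneq (x s : 'Z_(m s)) (t s).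
  by under eq_bigr do rewrite rho_eq // expr1n; rewrite sumr_const card_ord mulr1.
rewrite mulr0; have := subrX1 (rho s x t) (m s); rewrite rho_expm subrr => /esym/eqP.
by rewrite mulf_eq0 subr_eq0 (negbTE (rho_neq1 xt)) => /eqP.
Qed.

Lemma normc_geom_rho s a x t : normc (geom_rho s a x t) <= a%:R.
Proof.
apply: le_trans (normc_sum _ _ _) _.
by under eq_bigr do rewrite normcX normc_rho expr1n; rewrite sumr_const card_ord.
Qed.

(** This closed form is the reason why partial sums of order [M_s] are conditional expectations on
    the cylinders of level [s]. *)
Lemma dirichlet_bigM s x t : dirichlet (M s) x t = (M s)%:R * (agree s x t)%:R.
Proof.
elim: s => [|s IH].
  rewrite bigM0 /dirichlet big_ord_recl big_ord0 addr0 (psi_kernelE (N := 0)) ?bigM0 //.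
  have -> : agree 0 x t by apply/agreeP.
  by rewrite big_ord0 mulr1.
rewrite bigMS dirichlet_mulM // geom_rho_full IH agreeS natrM andbC.
by case: (_ == _); case: agree; rewrite ?(mulr0,mul0r,mulr1).
Qed.

Lemma fejer_sum_mixed s a r x t : (a < m s)%N -> (r <= M s)%N ->
  fejer_sum (a * M s + r) x t = fejer_sum (a * M s) x t
    + r%:R * (geom_rho s a x t * dirichlet (M s) x t) + rho s x t ^+ a * fejer_sum r x t.
Proof.
move=> am rM; rewrite {1}/fejer_sum big_split_ord /= -/(fejer_sum _ x t) -addrA.
congr (_ + _).
rewrite (eq_bigr (fun i : 'I_r => geom_rho s a x t * dirichlet (M s) x t
    + rho s x t ^+ a * dirichlet i x t)); last first.
  by move=> i _; rewrite dirichlet_mixed // ltnW // (leq_trans _ rM).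
by rewrite big_split sumr_const card_ord -mulr_sumr mulr_natl.
Qed.

Lemma fejer_sum_mulM s a x t : (a <= m s)%N ->
  fejer_sum (a * M s) x t =
  (\sum_(b < a) geom_rho s b x t) * (M s)%:R * dirichlet (M s) x t
    + geom_rho s a x t * fejer_sum (M s) x t.
Proof.
move=> am; rewrite {1}/fejer_sum (sum_mulnD a (M s) (fun k => dirichlet k x t)).
rewrite !mulr_suml -big_split; apply: eq_bigr => b _ /=.
rewrite (eq_bigr (fun i : 'I_(M s) => geom_rho s b x t * dirichlet (M s) x t
    + rho s x t ^+ b * dirichlet i x t)); last first.
  by move=> i _; rewrite dirichlet_mixed ?(leq_trans _ am) // ltnW.
by rewrite big_split sumr_const card_ord -mulr_sumr mulrAC mulr_natr.
Qed.

End Kernels.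

(** * Pointwise and mean bounds for the Fejer kernels *)

Section KernelBounds.
Variables (R : realType) (m : nat -> nat) (B : nat).
Hypothesis m_ge2 : forall k, (2 <= m k)%N.
Hypothesis m_le : forall k, (m k <= B)%N.
Local Notation M := (bigM m).
Local Notation X := (vilenkin m).
Implicit Types x t : X.

Lemma B_ge1 : 1 <= B%:R :> R.
Proof. by rewrite ler1n (leq_trans _ (m_le 0)) // m_gt0. Qed.

Lemma natm_le k : (m k)%:R <= B%:R :> R.
Proof. by rewrite ler_nat. Qed.

(* For [s <= k] the exception is vacuous and this is [agree s x t]. *)
Definition holed k s x t : bool :=
  [forall i : 'I_s, (i == k :> nat) || ((x i : 'Z_(m i)) == (t i : 'Z_(m i)))].

Lemma holedP k s x t :
  reflect (forall i, (i < s)%N -> i != k -> x i = t i) (holed k s x t).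
Proof.
apply: (iffP forallP) => [h i si ik|h i].
  by have /= := h (Ordinal si); rewrite (negbTE ik) => /eqP.
by case: eqVneq => //= ik; apply/eqP/h.
Qed.

Lemma holed_agree k s x t : (s <= k)%N -> holed k s x t = agree s x t.
Proof.
move=> sk; apply/holedP/agreeP => h i si => [|_]; last exact: h.
by apply: h => //; rewrite ltn_eqF // (leq_trans si).
Qed.

Lemma holedSn s x t : holed s s.+1 x t = agree s x t.
Proof.
apply/holedP/agreeP => h i si; first by apply: h; [rewrite ltnW|rewrite ltn_eqF].
by move=> si'; apply: h; rewrite ltn_neqAle si' -ltnS.
Qed.

Lemma holedS k s x t : (k < s)%N ->
  holed k s.+1 x t = holed k s x t && ((x s : 'Z_(m s)) == t s).
Proof.
move=> ks; apply/holedP/andP => [h|[/holedP h /eqP h'] i].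
  split; last by apply/eqP/h => //; rewrite gtn_eqF.
  by apply/holedP => i si; apply: h; rewrite ltnW.
by rewrite ltnS leq_eqVlt => /predU1P[->//|]; exact: h.
Qed.

(** The case [k = s] is [M_s |D_(M_s)|]. For [s <= L] the mean in [t] is at most [B * M_k], since
    the set where it is nonzero has measure at most [B / M_s]. *)
Definition hole_kernel k s x t : R := (M k)%:R * (M s)%:R * (holed k s x t)%:R.

Definition hole_sum s x t := \sum_(k < s.+1) hole_kernel k s x t.

Lemma hole_kernel_ge0 k s x t : 0 <= hole_kernel k s x t.
Proof. by rewrite !mulr_ge0. Qed.

Lemma hole_sum_ge0 s x t : 0 <= hole_sum s x t.
Proof. by apply: sumr_ge0 => k _; exact: hole_kernel_ge0. Qed.

Lemma hole_kernel_diag s x t :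
  (M s)%:R * normc (dirichlet R (M s) x t) = hole_kernel s s x t.
Proof.
rewrite dirichlet_bigM // ComplexField.Normc.normcM !normc_nat.
by rewrite /hole_kernel holed_agree // mulrA.
Qed.

Lemma hole_kernel_le_sum s x t : hole_kernel s s x t <= hole_sum s x t.
Proof.
by rewrite /hole_sum big_ord_recr /= lerDr sumr_ge0 // => k _; exact: hole_kernel_ge0.
Qed.

Lemma normc_sum_geom_rho s a x t : (a <= B)%N ->
  normc (\sum_(b < a) geom_rho R s b x t) <= a%:R * B%:R.
Proof.
move=> aB; apply: le_trans (normc_sum _ _ _) _.
apply: le_trans (_ : \sum_(b < a) B%:R <= _).
  apply: ler_sum => b _; apply: le_trans (normc_geom_rho _ _ _ _ _) _.
  by rewrite ler_nat (leq_trans _ aB) // ltnW.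
by rewrite sumr_const card_ord mulr_natl.
Qed.

(* Passing from [M_s] to [M_(s+1)] multiplies the old kernel by
   [1 + rho + ... + rho^(m_s - 1)], i.e. by [m_s] where the [s]-th coordinates
   agree and by 0 elsewhere; this turns [hole_kernel k s] into
   [hole_kernel k s.+1] and leaves the [D_(M_s)] term as [hole_kernel s s.+1]. *)
Lemma normc_fejer_sum_bigM s x t :
  normc (fejer_sum R (M s) x t) <= B%:R ^+ 2 * hole_sum s x t.
Proof.
have B0 : 0 <= B%:R ^+ 2 :> R by rewrite exprn_ge0.
elim: s => [|s IH].
  rewrite bigM0 /fejer_sum big_ord_recl big_ord0 addr0 /dirichlet big_ord0.
  by rewrite ComplexField.Normc.normc0 mulr_ge0 // hole_sum_ge0.
rewrite bigMS fejer_sum_mulM //; apply: (le_trans (normcD _ _)).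
rewrite -mulrA !ComplexField.Normc.normcM normc_nat hole_kernel_diag.
rewrite geom_rho_full // ComplexField.Normc.normcM !normc_nat.
rewrite /hole_sum big_ord_recr big_ord_recr /=.
have h1 : normc (\sum_(b < m s) geom_rho R s b x t) * hole_kernel s s x t
    <= B%:R ^+ 2 * hole_kernel s s.+1 x t.
  apply: le_trans (ler_wpM2r (hole_kernel_ge0 _ _ _ _) (normc_sum_geom_rho _ _ _ (m_le s))) _.
  rewrite /hole_kernel holed_agree // holedSn bigMS natrM expr2.
  have := B_ge1; have := ler0n R (agree s x t); have := ler0n R (m s).
  move: (m s)%:R (agree _ _ _)%:R => ms a ms0 a0 b1.
  have -> : ms * B%:R * ((M s)%:R * (M s)%:R * a) = 1 * (ms * B%:R * ((M s)%:R * (M s)%:R * a)) by rewrite mul1r.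
  rewrite (_ : B%:R * B%:R * _ = B%:R * (ms * B%:R * ((M s)%:R * (M s)%:R * a))); last by ring.
  by rewrite ler_wpM2r // !mulr_ge0.
have h2 : (m s)%:R * ((x s : 'Z_(m s)) == t s)%:R * normc (fejer_sum R (M s) x t)
   <= B%:R ^+ 2 * (\sum_(k < s) hole_kernel k s.+1 x t + hole_kernel s.+1 s.+1 x t).
  apply: le_trans (ler_wpM2l _ IH) _; first by rewrite mulr_ge0.
  rewrite mulrCA ler_wpM2l // /hole_sum big_ord_recr /= mulrDr lerD //.
    rewrite mulr_sumr; apply: ler_sum => k _; rewrite /hole_kernel holedS // bigMS natrM.
    by case: (_ == _); case: holed; rewrite ?(mulr0,mul0r,mulr1) //= mulrCA.
  rewrite /hole_kernel !holed_agree // agreeS; case: (_ == _); rewrite ?andbT ?andbF ?mulr0 ?mul0r //.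
  rewrite mulr1 !mulrA ler_wpM2r // bigMS natrM !mulrA ler_wpM2r //.
  by rewrite ler_peMr ?mulr_ge0 // ler1n m_gt0.
rewrite (_ : B%:R ^+ 2 * (_ + _ + _) = B%:R ^+ 2 *
  (\sum_(k < s) hole_kernel k s.+1 x t + hole_kernel s.+1 s.+1 x t) +
   B%:R ^+ 2 * hole_kernel s s.+1 x t); last by ring.
by rewrite addrC lerD.
Qed.

(** Peeling off the top digit leaves the kernel of the remainder with a factor of modulus 1, so
    constants do not accumulate over the levels. The three other terms cost [B^2], [B^3] and [B]
    times [hole_sum N], together at most [3 B^3]. *)
Lemma normc_fejer_sum N n x t : (n < M N)%N ->
  normc (fejer_sum R n x t) <= 3 * B%:R ^+ 3 * \sum_(s < N) hole_sum s x t.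
Proof.
elim: N n => [|N IH] n.
  rewrite bigM0 ltnS leqn0 => /eqP ->; rewrite /fejer_sum big_ord0.
  by rewrite big_ord0 mulr0 ComplexField.Normc.normc0.
move=> /(mixed_radix m_ge2)[a [r [am rM ->]]].
have aB : (a <= B)%N by rewrite (leq_trans (ltnW am)).
rewrite fejer_sum_mixed // ?(ltnW rM) //.
rewrite big_ord_recr mulrDr /= addrC; apply: (le_trans (normcD _ _)).
rewrite ComplexField.Normc.normcM normcX normc_rho expr1n mul1r addrC.
rewrite [leRHS]addrC lerD ?IH //; apply: (le_trans (normcD _ _)).
rewrite fejer_sum_mulM ?(ltnW am) //.
rewrite -mulrA; apply: (le_trans (lerD (normcD _ _) (lexx _))).
rewrite !ComplexField.Normc.normcM !normc_nat hole_kernel_diag.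
have b1 := B_ge1; have b0 : 0 <= B%:R :> R by [].
have hE := hole_kernel_le_sum N x t; have e0 := hole_kernel_ge0 N N x t.
have h1 : normc (\sum_(b < a) geom_rho R N b x t) * hole_kernel N N x t
    <= B%:R ^+ 2 * hole_sum N x t.
  apply: ler_pM => //; first exact: normc_ge0.
  apply: le_trans (normc_sum_geom_rho _ _ _ aB) _.
  by rewrite expr2 ler_wpM2r // ler_nat.
have g1 : normc (geom_rho R N a x t) <= B%:R.
  by apply: le_trans (normc_geom_rho _ _ _ _ _) _; rewrite ler_nat.
have h2 : normc (geom_rho R N a x t) * normc (fejer_sum R (M N) x t)
    <= B%:R * (B%:R ^+ 2 * hole_sum N x t).
  by apply: ler_pM => //; [exact: normc_ge0|exact: normc_ge0|exact: normc_fejer_sum_bigM].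
have h3 : r%:R * (normc (geom_rho R N a x t) * normc (dirichlet R (M N) x t))
    <= B%:R * hole_sum N x t.
  rewrite mulrCA; apply: ler_pM => //; first exact: normc_ge0.
    by rewrite mulr_ge0 // normc_ge0.
  apply: le_trans hE; rewrite -hole_kernel_diag ler_wpM2r ?normc_ge0 //.
  by rewrite ler_nat ltnW.
apply: (le_trans (lerD (lerD h1 h2) h3)).
have h0 := hole_sum_ge0 N x t.
rewrite [B%:R * (_ * _)]mulrA -exprS -!mulrDl ler_wpM2r //.
have B2 : B%:R ^+ 2 <= B%:R ^+ 3 :> R by apply: ler_weXn2l.
have B1 : B%:R <= B%:R ^+ 3 :> R by rewrite ler_eXnr.
lra.
Qed.

(** The set is covered by the [m_k] cylinders of level [s] obtained from [x] by giving the [k]-th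
    coordinate each possible value. *)
Lemma av_holed_le L s k x : (s <= L)%N ->
  av L (fun t => (holed k s x t)%:R) <= B%:R / (M s)%:R :> R.
Proof.
move=> sL.
apply: le_trans (_ : av L (fun t => \sum_(a : 'Z_(m k))
    (agree s (dfwith x k a) t)%:R) <= _).
  apply: av_le => // t; case: (boolP (holed k s x t)) => [/holedP h|_]; last by rewrite sumr_ge0.
  rewrite (bigD1 (t k : 'Z_(m k))) //=.
  have -> : agree s (dfwith x k (t k : 'Z_(m k))) t.
    apply/agreeP => i si; have [->|ik] := eqVneq i k; first by rewrite dfwithin.
    by rewrite dfwithout 1?eq_sym //; apply: h.
  by rewrite lerDl sumr_ge0.
rewrite av_sum; under eq_bigr do rewrite av_cyl //.
rewrite sumr_const card_ord Zp_truncK // -[_ *+ m k]mulr_natl.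
by rewrite ler_wpM2r ?invr_ge0 // natm_le.
Qed.

Lemma sum_bigM_le s : \sum_(k < s.+1) (M k)%:R <= 2 * (M s)%:R :> R.
Proof.
have := @sum_geom_increasing R (fun k => (M k)%:R) 2; rewrite ltr1n => /(_ isT) h.
apply: le_trans (h _ _ s) _ => [k|k|]; rewrite ?ler0n //.
  by rewrite -natrM ler_nat leq_double_bigM.
by rewrite (_ : 2 - 1 = 1) ?divr1 //; ring.
Qed.

Lemma av_hole_sum_le L N x : (N <= L.+1)%N ->
  av L (fun t => \sum_(s < N) hole_sum s x t) <= 2 * B%:R * (M N)%:R.
Proof.
move=> NL; rewrite av_sum.
have h (s : 'I_N) : av L (hole_sum s x) <= 2 * B%:R * (M s)%:R.
  rewrite /hole_sum av_sum; apply: le_trans (_ : \sum_(k < s.+1) B%:R * (M k)%:R <= _).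
    apply: ler_sum => k _; rewrite /hole_kernel avZ.
    have sL : (s <= L)%N by rewrite -ltnS (leq_trans (ltn_ord s)).
    apply: le_trans (ler_wpM2l _ (av_holed_le k x sL)) _; first by rewrite mulr_ge0.
    rewrite [B%:R / _]mulrC mulrA mulfK ?natM_neq0 // mulrC //.
  by rewrite -mulr_sumr -mulrA mulrCA ler_wpM2l // sum_bigM_le.
apply: (le_trans (ler_sum _ (fun s _ => h s))).
rewrite -mulr_sumr ler_wpM2l ?mulr_ge0 //.
case: N {NL h} => [|N]; first by rewrite big_ord0.
by apply: (le_trans (sum_bigM_le N)); rewrite -natrM ler_nat leq_double_bigM.
Qed.

Lemma bigM_bracket n : (0 < n)%N -> exists N, (M N <= n < M N.+1)%N.
Proof.
move=> n0; have ex : exists N, (M N <= n)%N by exists 0%N; rewrite bigM0.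
have bd N : (M N <= n)%N -> (N <= n)%N.
  by move=> h; rewrite ltnW // (leq_trans (ltn_bigM m_ge2 N)).
case: (ex_maxnP ex bd) => N h1 h2; exists N; rewrite h1 ltnNge.
by apply/negP => /h2; rewrite ltnn.
Qed.

Lemma bigMS_le N : (M N.+1 <= B * M N)%N.
Proof. by rewrite bigMS leq_mul2r m_le orbT. Qed.

Lemma leq_bigM_exp N L : (M N <= M L)%N -> (N <= L)%N.
Proof.
apply: contraTT; rewrite -!ltnNge => LN; apply: leq_trans (leq_bigM m_ge2 LN).
by apply: leq_trans (leq_double_bigM m_ge2 L); rewrite mul2n -addnn -[X in (X < _)%N]addn0 ltn_add2l bigM_gt0.
Qed.

(** Uniform boundedness in mean of the Fejer kernels. The constant is [3 B^3] from the pointwise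
    bound, [2 B] from averaging it, and [B] from [M_(N+1) <= B M_N <= B n]. *)
Lemma av_normc_fejer_sum L n x : (n <= M L)%N ->
  av L (fun t => normc (fejer_sum R n x t)) <= 6 * B%:R ^+ 5 * n%:R.
Proof.
case: n => [|n] nL.
  rewrite mulr0 /fejer_sum; under eq_av do rewrite big_ord0 ComplexField.Normc.normc0.
  by rewrite av_cst.
have [//|N /andP[h1 h2]] := @bigM_bracket n.+1.
have NL : (N <= L)%N by apply: leq_bigM_exp; exact: leq_trans nL.
apply: le_trans (av_le m_ge2 L (fun t => normc_fejer_sum x t h2)) _.
rewrite avZ; apply: le_trans (ler_wpM2l _ (av_hole_sum_le x (_ : N.+1 <= L.+1)%N)) _ => //.
have h3 : (M N.+1)%:R <= B%:R * n.+1%:R :> R.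
  by rewrite -natrM ler_nat (leq_trans (bigMS_le N)) // leq_mul2l h1 orbT.
apply: le_trans (ler_wpM2l _ (ler_wpM2l _ h3)) _; rewrite ?mulr_ge0 //.
by rewrite le_eqVlt; apply/orP; left; apply/eqP; ring.
Qed.

End KernelBounds.

(** * Kernels averaged over a cylinder and evaluated outside it *)

Section OuterBound.
Variables (R : realType) (m : nat -> nat) (B : nat).
Hypothesis m_ge2 : forall k, (2 <= m k)%N.
Hypothesis m_le : forall k, (m k <= B)%N.
Local Notation M := (bigM m).
Local Notation X := (vilenkin m).
Implicit Types x t : X.

(* The average over [t] in the cylinder [I_N(x0)] of the bound for the Fejer
   kernels, for [x] outside that cylinder: the levels [s < N] see a constant
   kernel, and each level [N <= s < N'] contributes the same amount. *)
Definition outer_bound N N' x0 x : R :=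
  \sum_(s < N) \sum_(k < s.+1) (M k)%:R * (M s)%:R / (M N)%:R * (holed k s x0 x)%:R
  + (N' - N)%:R * \sum_(k < N) (M k)%:R * (holed k N x0 x)%:R.

Lemma av_hole_sum_outer L N N' x0 x : (N <= L)%N -> (N <= N')%N -> (N' <= L.+1)%N ->
  ~~ agree N x0 x ->
  av L (fun t => \sum_(s < N') hole_sum R s x t * (agree N x0 t)%:R)
    <= outer_bound N N' x0 x.
Proof.
move=> NL NN' N'L nx; rewrite av_sum -(big_mkord predT
  (fun s => av L (fun t => hole_sum R s x t * (agree N x0 t)%:R))).
rewrite (big_cat_nat (n := N)) //= /outer_bound lerD //.
  rewrite big_mkord; apply: ler_sum => s _.
  have -> : av L (fun t => hole_sum R s x t * (agree N x0 t)%:R) =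
      \sum_(k < s.+1) av L (fun t => hole_kernel R k s x t * (agree N x0 t)%:R).
    by rewrite -av_sum; apply: eq_av => t; rewrite mulr_suml.
  apply: ler_sum => k _.
  have -> : av L (fun t => hole_kernel R k s x t * (agree N x0 t)%:R) =
      (M k)%:R * (M s)%:R * (holed k s x0 x)%:R * av L (fun t => (agree N x0 t)%:R).
    rewrite -avZ; apply: eq_av => t; rewrite /hole_kernel -!mulrA; congr (_ * (_ * _)).
    case: (boolP (agree N x0 t)) => [/agreeP h|_]; last by rewrite !mulr0.
    rewrite !mulr1; congr (nat_of_bool _)%:R; apply/holedP/holedP => h' i si ik.
      by rewrite h ?h' // (leq_trans si) // ltnW.
    by rewrite -h' // h // (leq_trans si) // ltnW.
  rewrite av_cyl //.
  by rewrite mulrAC.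
rewrite -[X in X * _]mulr1; apply: le_trans (_ : \sum_(N <= s < N') \sum_(k < N) (M k)%:R * (holed k N x0 x)%:R <= _); last first.
  by rewrite sumr_const_nat mulr1 mulr_natl.
apply: ler_sum_nat => s /andP[Ns sN'].
have -> : av L (fun t => hole_sum R s x t * (agree N x0 t)%:R) =
    \sum_(k < s.+1) av L (fun t => hole_kernel R k s x t * (agree N x0 t)%:R).
  by rewrite -av_sum; apply: eq_av => t; rewrite mulr_suml.
rewrite -(big_mkord predT (fun k => av L (fun t => hole_kernel R k s x t * (agree N x0 t)%:R))).
rewrite -(big_mkord predT (fun k => (M k)%:R * (holed k N x0 x)%:R)).
rewrite (big_cat_nat (n := N)) ?(leqW Ns) //= [X in _ + X]big_nat_cond [X in _ + X]big1 ?addr0.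
  apply: ler_sum_nat => k /= kN.
  (* Where the integrand is nonzero, [t] is determined up to level [s]: it follows [x0] below [N]
     and, the hole [k] being below [N], it follows [x] from there on. The resulting mass [1 / M_s]
     cancels the factor [M_s]. *)
  pose z : X := fun i => if (i < N)%N then x0 i else x i.
  apply: le_trans (_ : av L (fun t => (M k)%:R * (M s)%:R * (holed k N x0 x)%:R * (agree s z t)%:R) <= _).
    apply: av_le => // t; rewrite /hole_kernel -!mulrA ler_wpM2l // ler_wpM2l //.
    case: (boolP (holed k s x t)) => [/holedP h|_]; last by rewrite mul0r mulr_ge0.
    case: (boolP (agree N x0 t)) => [/agreeP h'|_]; last by rewrite mulr0 mulr_ge0.
    have -> : holed k N x0 x.
      by apply/holedP => i iN ik; rewrite h' // -h // (leq_trans iN).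
    have -> // : agree s z t.
    apply/agreeP => i si; rewrite /z; case: ltnP => iN; first exact: h'.
    by apply: h => //; rewrite gtn_eqF // (leq_trans kN).
  rewrite avZ av_cyl //; last by rewrite -ltnS (leq_trans sN').
  by rewrite mulrAC mulfK ?natM_neq0.
(* With a hole [k >= N], the point [t] would agree below [N] with both [x] and [x0], which is
   impossible for [x] outside the cylinder. *)
move=> k; rewrite andbT => /andP[Nk _]; rewrite -(av_cst m_ge2 (V := R) L 0); apply: eq_av => t.
rewrite /hole_kernel; case: (boolP (agree N x0 t)) => [h'|_]; last by rewrite mulr0.
case: (boolP (holed k s x t)) => [/holedP h|_]; last by rewrite mulr0 mul0r.
case/negP: nx; apply: (agree_trans h'); rewrite agree_sym; apply/agreeP => i iN.
by apply: h; [rewrite (leq_trans iN)|rewrite ltn_eqF // (leq_trans iN)].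
Qed.

(** Powers pass inside all sums and leave indicators unchanged. Level [s] then gives
    [M_k^p M_s^p M_N^(-p)] times a measure at most [B / M_s], and the geometric sum over [k <= s]
    produces the exponent [2p - 1]. *)
Lemma av_outer_bound_powR L N N' x0 p : 0 < p <= 1 -> (N <= L)%N ->
  av L (fun x => outer_bound N N' x0 x `^ p) <=
  B%:R * (2 `^ p / (2 `^ p - 1)) * ((M N)%:R `^ (- p) *
    \sum_(s < N) (M s)%:R `^ (2 * p - 1) + (N' - N)%:R * (M N)%:R `^ (p - 1)) .
Proof.
move=> hp NL; case/andP: (hp) => p0 p1.
have b1 : 1 < 2 `^ p :> R by exact: powR2_gt1.
set c := 2 `^ p / (2 `^ p - 1).
have Mp s : 0 < (M s)%:R :> R by rewrite ltr0n bigM_gt0.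
have Ml s := ltW (Mp s).
have Mn s : (M s)%:R != 0 :> R by rewrite gt_eqF.
have geo s : \sum_(k < s.+1) (M k)%:R `^ p <= c * (M s)%:R `^ p :> R.
  apply: (@sum_geom_increasing R (fun k => (M k)%:R `^ p)) => // k.
  rewrite -powRM // ge0_ler_powR ?nnegrE ?(ltW p0) ?mulr_ge0 //.
  by rewrite -natrM ler_nat leq_double_bigM.
have bp (b : bool) : b%:R `^ p = b%:R :> R by case: b; rewrite ?powR1 ?powR0 ?gt_eqF.
have hol k s : (s <= L)%N -> av L (fun x => (holed k s x0 x)%:R `^ p) <= B%:R / (M s)%:R :> R.
  by move=> sL; under eq_av do rewrite bp; exact: av_holed_le.
apply: le_trans (_ : av L (fun x =>
   \sum_(s < N) \sum_(k < s.+1) ((M k)%:R * (M s)%:R / (M N)%:R) `^ p * (holed k s x0 x)%:R `^ p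
   + (N' - N)%:R * \sum_(k < N) (M k)%:R `^ p * (holed k N x0 x)%:R `^ p) <= _).
  apply: av_le => // x; rewrite /outer_bound.
  apply: le_trans (powR_subadditive hp _ _) _.
  - by apply: sumr_ge0 => s _; apply: sumr_ge0 => k _; rewrite !mulr_ge0 ?invr_ge0.
  - by rewrite mulr_ge0 // sumr_ge0 // => k _; rewrite mulr_ge0.
  apply: lerD.
    apply: le_trans (powR_sum_le _ hp _) _ => [s _|].
      by apply: sumr_ge0 => k _; rewrite !mulr_ge0 ?invr_ge0.
    apply: ler_sum => s _.
    apply: le_trans (powR_sum_le _ hp _) _ => [k _|].
      by rewrite !mulr_ge0 ?invr_ge0.
    by apply: ler_sum => k _; rewrite powRM // !mulr_ge0 ?invr_ge0.
  rewrite powRM //; last by apply: sumr_ge0 => k _; rewrite mulr_ge0.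
  apply: ler_pM; rewrite ?powR_ge0 //.
    (* A natural number dominates its [p]-th power; zero is separate because the comparison of
       powers requires a base at least 1. *)
    case: (N' - N)%N => [|u]; first by rewrite powR0 // gt_eqF.
    by rewrite ler1_powR // ler1n.
  apply: le_trans (powR_sum_le _ hp _) _ => [k _|]; first by rewrite mulr_ge0.
  by apply: ler_sum => k _; rewrite powRM.
rewrite avD av_sum avZ av_sum mulrDr lerD //.
  rewrite mulrA mulr_sumr; apply: ler_sum => s _.
  rewrite av_sum; apply: le_trans (_ : \sum_(k < s.+1) (M k)%:R `^ p * ((M s)%:R `^ p * (M N)%:R `^ (-p) * (B%:R / (M s)%:R)) <= _).
    apply: ler_sum => k _; rewrite avZ mulrA.
    have -> : ((M k)%:R * (M s)%:R / (M N)%:R) `^ p =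
        (M k)%:R `^ p * ((M s)%:R `^ p * (M N)%:R `^ (- p)) :> R.
      rewrite powRM ?invr_ge0 ?mulr_ge0 // powRM // -!mulrA.
      by rewrite -(powR_inv1 (Ml N)) -powRrM mulN1r.
    by rewrite ler_wpM2l ?mulr_ge0 ?powR_ge0 // hol // ltnW // (leq_trans (ltn_ord s)).
  rewrite -mulr_suml; apply: le_trans (ler_wpM2r _ (geo s)) _.
    by rewrite !mulr_ge0 ?powR_ge0 ?invr_ge0.
  have -> : (M s)%:R `^ (2 * p - 1) = (M s)%:R `^ p * (M s)%:R `^ p / (M s)%:R :> R.
    rewrite (_ : 2 * p - 1 = p + (p - 1)); last by ring.
    rewrite powRD; last by rewrite Mn implybT.
    by rewrite powRB ?powRr1 ?mulrA // Mn implybT.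
  by rewrite le_eqVlt; apply/orP; left; apply/eqP; ring.
rewrite mulrCA ler_wpM2l //.
apply: le_trans (_ : \sum_(k < N) (M k)%:R `^ p * (B%:R / (M N)%:R) <= _).
  by apply: ler_sum => k _; rewrite avZ ler_wpM2l ?powR_ge0 // hol.
rewrite -mulr_suml; apply: le_trans (_ : c * (M N)%:R `^ p * (B%:R / (M N)%:R) <= _).
  rewrite ler_wpM2r ?divr_ge0 //; apply: le_trans (geo N).
  by rewrite big_ord_recr lerDl powR_ge0.
rewrite powRB ?Mn ?implybT // powRr1 //.
by rewrite le_eqVlt; apply/orP; left; apply/eqP; ring.
Qed.

End OuterBound.

(** * Summation by parts with non-increasing weights *)

Section SummationByParts.
Variable R : realType.
Implicit Types q : nat -> R.

Lemma abel_sum (V : pzRingType) (a u : nat -> V) n :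
  \sum_(k < n.+1) a k * u k =
  \sum_(j < n) (a j - a j.+1) * (\sum_(k < j.+1) u k) + a n * \sum_(k < n.+1) u k.
Proof.
elim: n => [|n IH]; first by rewrite !big_ord_recl !big_ord0 add0r !addr0.
rewrite big_ord_recr IH [in RHS]big_ord_recr /= -!addrA; congr (_ + _).
rewrite [X in _ = _ + _ * X]big_ord_recr /= mulrDr mulrBl.
by rewrite addrA subrK.
Qed.

Lemma Qsum_abel q n : Qsum q n.+1 =
  \sum_(j < n) (q j - q j.+1) * j.+1%:R + q n * n.+1%:R.
Proof.
have := abel_sum q (fun=> 1) n; rewrite /Qsum.
under eq_bigr do rewrite mulr1.
by under [in X in _ = X + _]eq_bigr do rewrite sumr_const card_ord; rewrite sumr_const card_ord.
Qed.

Lemma normc_abel q (u : nat -> R[i]) n :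
  (forall k, 0 <= q k) -> (forall i j, (i <= j)%N -> q j <= q i) ->
  normc (\sum_(k < n.+1) (q k)%:C * u k) <=
  \sum_(j < n) (q j - q j.+1) * normc (\sum_(k < j.+1) u k)
    + q n * normc (\sum_(k < n.+1) u k).
Proof.
move=> q0 qd.
rewrite (abel_sum (fun k => (q k)%:C) u n).
apply: le_trans (normcD _ _) _; apply: lerD; last first.
  by rewrite ComplexField.Normc.normcM normc_real ger0_norm.
apply: le_trans (normc_sum _ _ _) _; apply: ler_sum => j _.
by rewrite -rmorphB ComplexField.Normc.normcM normc_real ger0_norm // subr_ge0 qd.
Qed.

Lemma Qsum_gt0 q n : (forall k, 0 <= q k) -> 0 < q 0%N -> (0 < n)%N -> 0 < Qsum q n.
Proof.
move=> q0 q1; case: n => // n _; rewrite /Qsum big_ord_recl.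
by rewrite ltr_wpDr // sumr_ge0.
Qed.

(** Taken at [k = M_N], it bounds [q (M_N) / Q_n] by [1 / M_N], independently of [q]. *)
Lemma le_Qsum q k n : (forall k, 0 <= q k) -> (forall i j, (i <= j)%N -> q j <= q i) ->
  (k <= n)%N -> k%:R * q k <= Qsum q n.
Proof.
move=> q0 qd kn; rewrite /Qsum -(big_mkord predT) (big_cat_nat (n := k)) //=.
rewrite -[X in X <= _]addr0 lerD ?sumr_ge0 //.
rewrite big_mkord mulr_natl -[X in _ *+ X](card_ord k) -sumr_const.
by apply: ler_sum => i _; rewrite qd // ltnW.
Qed.

End SummationByParts.

(** * The means at a finite level, and their action on one atom *)

Section FiniteMeans.
Variables (R : realType) (m : nat -> nat) (B : nat).
Hypothesis m_ge2 : forall k, (2 <= m k)%N.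
Hypothesis m_le : forall k, (m k <= B)%N.
Local Notation M := (bigM m).
Local Notation X := (vilenkin m).
Implicit Types (x t : X) (g : X -> R[i]).

Definition av_coef L g i : R[i] := av L (fun t => g t * (psi R i t)^*).

Definition av_mean (q : nat -> R) L n g x : R[i] :=
  ((Qsum q n)^-1)%:C * \sum_(k < n) (q k)%:C * partial_sum (av_coef L g) k x.

Lemma partial_sum_av L g k x :
  partial_sum (av_coef L g) k x = av L (fun t => g t * dirichlet R k x t).
Proof.
rewrite /partial_sum.
have -> : av L (fun t => g t * dirichlet R k x t) =
    \sum_(i < k) av L (fun t => g t * psi_kernel R i x t).
  by rewrite -av_sum; apply: eq_av => t; rewrite mulr_sumr.
apply: eq_bigr => i _; rewrite /av_coef mulrC -avZ; apply: eq_av => t.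
by rewrite /psi_kernel mulrCA.
Qed.

Lemma sum_partial_sum_av L g n x :
  \sum_(k < n) partial_sum (av_coef L g) k x = av L (fun t => g t * fejer_sum R n x t).
Proof.
have -> : av L (fun t => g t * fejer_sum R n x t) =
    \sum_(i < n) av L (fun t => g t * dirichlet R i x t).
  by rewrite -av_sum; apply: eq_av => t; rewrite mulr_sumr.
by apply: eq_bigr => i _; rewrite partial_sum_av.
Qed.

Section Means.
Variable q : nat -> R.
Hypothesis q_ge0 : forall k, 0 <= q k.
Hypothesis q0_gt0 : 0 < q 0%N.
Hypothesis q_noninc : forall i j, (i <= j)%N -> q j <= q i.

(** The [j]-th kernel sum has mean at most a multiple of [j], and by [Qsum_abel] the same weights
    applied to [j] itself add up to [Q_n]. This gives a bound uniform in [n] and [q]. *)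
Lemma normc_av_mean_le L n g u x : (0 < n <= M L)%N -> (forall t, normc (g t) <= u) ->
  normc (av_mean q L n g x) <= 6 * B%:R ^+ 5 * u.
Proof.
case: n => // n /andP[_ nL] gu.
have Q0 : 0 < Qsum q n.+1 by exact: Qsum_gt0.
have u0 : 0 <= u := le_trans (normc_ge0 _) (gu (pt m 0)).
rewrite /av_mean ComplexField.Normc.normcM normc_real ger0_norm ?invr_ge0 ?(ltW Q0) //.
rewrite ler_pdivrMl //.
apply: le_trans (normc_abel (fun k => partial_sum (av_coef L g) k x) n q_ge0 q_noninc) _.
have h j : (j <= M L)%N ->
    normc (\sum_(k < j) partial_sum (av_coef L g) k x) <= 6 * B%:R ^+ 5 * u * j%:R.
  move=> jL; rewrite sum_partial_sum_av; apply: le_trans (normc_av m_ge2 _ _) _.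
  apply: le_trans (_ : av L (fun t => u * normc (fejer_sum R j x t)) <= _).
    by apply: av_le => // t; rewrite ComplexField.Normc.normcM ler_wpM2r ?normc_ge0.
  rewrite avZ; apply: le_trans (ler_wpM2l u0 (av_normc_fejer_sum R m_ge2 m_le x jL)) _.
  by rewrite mulrA [u * _]mulrC.
rewrite Qsum_abel mulrDl mulr_suml; apply: lerD; last first.
  by rewrite -(mulrA (q n)) ler_wpM2l // [leRHS]mulrC h.
apply: ler_sum => j _; rewrite -(mulrA (q j - q j.+1)) ler_wpM2l ?subr_ge0 ?q_noninc // [leRHS]mulrC.
by apply: h; rewrite ltnW // (leq_trans _ nL) // ltnS ltn_ord.
Qed.

(* Unnormalized atoms: the height [u] need not be related to the measure
   [1 / M N] of the supporting cylinder. *)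
Definition atom L N x0 u g :=
  (forall t, normc (g t) <= u * (agree N x0 t)%:R) /\
  (forall j, (j < M N)%N -> av_coef L g j = 0).

Section Atom.
Variables (L N : nat) (x0 : X) (u : R) (g : X -> R[i]).
Hypotheses (NL : (N <= L)%N) (g_atom : atom L N x0 u g).

Lemma atom_partial_sum0 k x : (k <= M N)%N -> partial_sum (av_coef L g) k x = 0.
Proof.
move=> kN; rewrite /partial_sum big1 // => i _; case: g_atom => _ ->; first by rewrite mul0r.
exact: leq_trans kN.
Qed.

Lemma atom_mean0 n x : (n <= M N)%N -> av_mean q L n g x = 0.
Proof.
move=> nN; rewrite /av_mean big1 ?mulr0 // => k _.
by rewrite atom_partial_sum0 ?mulr0 // (leq_trans _ nN) // ltnW.
Qed.

Lemma atom_u_ge0 : 0 <= u.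
Proof. by case: g_atom => /(_ x0) + _; rewrite agree_refl mulr1; apply: le_trans (normc_ge0 _). Qed.

Lemma atom_mean_outer n N' x : (M N < n)%N -> (n < M N')%N -> (N' <= L.+1)%N ->
  ~~ agree N x0 x ->
  normc (av_mean q L n g x) <=
    q (M N) / Qsum q n * (3 * B%:R ^+ 3 * u * outer_bound R N N' x0 x).
Proof.
case: n => // n; rewrite ltnS => Nn nN' N'L nx.
have NN' : (N <= N')%N.
  by apply: leq_bigM_exp => //; rewrite ltnW // (leq_ltn_trans Nn) // ltnW.
have Q0 : 0 < Qsum q n.+1 by exact: Qsum_gt0.
set w := 3 * B%:R ^+ 3 * u * outer_bound R N N' x0 x.
rewrite /av_mean ComplexField.Normc.normcM normc_real ger0_norm ?invr_ge0 ?(ltW Q0) //.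
rewrite -mulrA mulrCA ler_wpM2l ?invr_ge0 ?(ltW Q0) //.
apply: le_trans (normc_abel (fun k => partial_sum (av_coef L g) k x) n q_ge0 q_noninc) _.
have hw j : (j < M N')%N -> normc (\sum_(k < j) partial_sum (av_coef L g) k x) <= w.
  move=> jN'; rewrite sum_partial_sum_av; apply: le_trans (normc_av m_ge2 _ _) _.
  apply: le_trans (_ : av L (fun t => 3 * B%:R ^+ 3 * u *
      (\sum_(s < N') hole_sum R s x t * (agree N x0 t)%:R)) <= _); last first.
    rewrite avZ; apply: ler_wpM2l; first by rewrite !mulr_ge0 // ?atom_u_ge0 // exprn_ge0.
    exact: av_hole_sum_outer.
  apply: av_le => // t; rewrite ComplexField.Normc.normcM.
  have [gu _] := g_atom.
  apply: le_trans (ler_pM (normc_ge0 _) (normc_ge0 _) (gu t)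
      (normc_fejer_sum R m_ge2 m_le x t jN')) _.
  by rewrite -mulr_suml le_eqVlt; apply/orP; left; apply/eqP; ring.
have h0 j : (j <= M N)%N -> \sum_(k < j) partial_sum (av_coef L g) k x = 0.
  by move=> jN; rewrite big1 // => k _; apply: atom_partial_sum0; rewrite ltnW // (leq_trans _ jN).
(* The sums up to [j.+1] vanish for [j < M N]. The surviving weights telescope to [q (M N) - q n],
   and the boundary term restores [q n]. *)
have -> : q (M N) * w = \sum_(M N <= j < n) (q j - q j.+1) * w + q n * w.
  rewrite -mulr_suml -mulrDl; congr (_ * _).
  have := telescope_sumr (fun j => - q j) Nn.
  under eq_bigr do rewrite opprK addrC.
  by move=> ->; rewrite opprK addrAC addNr add0r.
apply: lerD; last by apply: ler_wpM2l => //; exact: hw.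
rewrite -(big_mkord predT (fun j => (q j - q j.+1) * normc (\sum_(k < j.+1) partial_sum (av_coef L g) k x))).
rewrite (big_cat_nat (n := M N)) //= [X in X + _]big_nat_cond [X in X + _]big1 ?add0r => [|j].
  apply: ler_sum_nat => j /andP[_ jn]; apply: ler_wpM2l; first by rewrite subr_ge0 q_noninc.
  by apply: hw; apply: ltn_trans nN'; rewrite ltnS.
by rewrite andbT => /andP[_ jN]; rewrite h0 // ComplexField.Normc.normc0 mulr0.
Qed.

Lemma outer_bound_ge0 N' x : 0 <= outer_bound R N N' x0 x.
Proof.
rewrite addr_ge0 //; last by rewrite mulr_ge0 // sumr_ge0 // => k _; rewrite mulr_ge0.
apply: sumr_ge0 => s _; by apply: sumr_ge0 => k _; rewrite !mulr_ge0 ?invr_ge0.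
Qed.

Lemma atom_mean_powR n N' p : 0 < p <= 1 ->
  (M N < n)%N -> (n < M N')%N -> (N' <= L.+1)%N -> (n <= M L)%N ->
  av L (fun x => normc (av_mean q L n g x) `^ p) <=
  ((6 * B%:R ^+ 5) `^ p + (3 * B%:R ^+ 3) `^ p * (B%:R * (2 `^ p / (2 `^ p - 1)))) *
  (u `^ p * ((M N)%:R^-1 + (q (M N) / Qsum q n) `^ p * ((M N)%:R `^ (- p) *
    \sum_(s < N) (M s)%:R `^ (2 * p - 1) + (N' - N)%:R * (M N)%:R `^ (p - 1)))).
Proof.
move=> hp Nn nN' N'L nL; have p0 : 0 < p by case/andP: hp.
have n0 : (0 < n)%N by rewrite (leq_ltn_trans _ Nn).
have Q0 : 0 < Qsum q n by exact: Qsum_gt0.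
have u0 := atom_u_ge0.
have b1 : 1 < 2 `^ p :> R by exact: powR2_gt1.
have b0 : 0 <= 2 `^ p / (2 `^ p - 1) :> R.
  by rewrite divr_ge0 ?powR_ge0 // subr_ge0 ltW.
set c := 2 `^ p / _ in b0 *; set Z := (M N)%:R `^ (- p) * _ + _.
have Z0 : 0 <= Z.
  rewrite addr_ge0 ?mulr_ge0 ?powR_ge0 ?sumr_ge0 // => s _; exact: powR_ge0.
set D := q (M N) / Qsum q n.
have D0 : 0 <= D by rewrite divr_ge0 // ltW.
have key x : ~~ agree N x0 x -> normc (av_mean q L n g x) <=
    D * (3 * B%:R ^+ 3 * u * outer_bound R N N' x0 x) by exact: atom_mean_outer.
clearbody D.
(* On the cylinder the uniform bound is integrated over mass [1 / M_N]; off it the power of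
   [outer_bound] carries all dependence on [x]. *)
apply: le_trans (_ : av L (fun x => (6 * B%:R ^+ 5 * u) `^ p * (agree N x0 x)%:R
    + (D * (3 * B%:R ^+ 3 * u)) `^ p * outer_bound R N N' x0 x `^ p) <= _).
  apply: av_le => // x; case: (boolP (agree N x0 x)) => h.
    rewrite mulr1 -[leLHS]addr0 lerD ?mulr_ge0 ?powR_ge0 //.
    rewrite ge0_ler_powR ?nnegrE ?normc_ge0 ?(ltW p0) ?mulr_ge0 ?exprn_ge0 //.
    apply: normc_av_mean_le; first by rewrite n0.
    move=> t; case: g_atom => /(_ t) + _ => /le_trans; apply.
    by rewrite ler_piMr //; case: agree.
  rewrite mulr0 add0r -powRM ?outer_bound_ge0 ?mulr_ge0 ?exprn_ge0 //.
  rewrite ge0_ler_powR ?nnegrE ?normc_ge0 ?(ltW p0) ?mulr_ge0 ?exprn_ge0 ?outer_bound_ge0 //.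
  by rewrite -mulrA key.
rewrite avD !avZ av_cyl //.
have ho := av_outer_bound_powR m_ge2 m_le N' x0 hp NL; rewrite -/c -/Z in ho.
apply: le_trans (lerD (lexx _) (ler_wpM2l (powR_ge0 _ _) ho)) _.
have c5 : 0 <= 6 * B%:R ^+ 5 :> R by rewrite mulr_ge0 // exprn_ge0.
have c3 : 0 <= 3 * B%:R ^+ 3 :> R by rewrite mulr_ge0 // exprn_ge0.
rewrite (powRM p c5 u0) (powRM p D0 (mulr_ge0 c3 u0)) (powRM p c3 u0).
have := powR_ge0 (6 * B%:R ^+ 5 : R) p; have := powR_ge0 (3 * B%:R ^+ 3 : R) p.
have := powR_ge0 u p; have := powR_ge0 D p; have : 0 <= B%:R * c by exact: mulr_ge0.
have : 0 <= (M N)%:R^-1 :> R by rewrite invr_ge0.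
move: (B%:R * c) (_^-1) (u `^ p) (D `^ p) ((6 * _) `^ p) ((3 * _) `^ p).
move=> bc i v w a6 a3 i0 bc0 w0 v0 a30 a60.
have E1 : 0 <= a6 * (v * (w * Z)) by rewrite !mulr_ge0.
have E2 : 0 <= a3 * bc * (v * i) by rewrite !mulr_ge0.
lra.
Qed.

End Atom.
End Means.
End FiniteMeans.

(** * Weighted sums over the index [n] for one atom *)

Section AtomSums.
Variables (R : realType) (m : nat -> nat) (B : nat).
Hypothesis m_ge2 : forall k, (2 <= m k)%N.
Hypothesis m_le : forall k, (m k <= B)%N.
Local Notation M := (bigM m).
Local Notation X := (vilenkin m).

Lemma double_bigM_exp N k : (2 ^ k * M N <= M (N + k))%N.
Proof.
elim: k => [|k IH]; first by rewrite mul1n addn0.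
rewrite expnS -mulnA addnS (leq_trans _ (leq_double_bigM m_ge2 _)) //.
by rewrite leq_mul2l IH orbT.
Qed.

Definition atom_const p : R :=
  (6 * B%:R ^+ 5) `^ p + (3 * B%:R ^+ 3) `^ p * (B%:R * (2 `^ p / (2 `^ p - 1))).

Lemma atom_const_ge0 p : 0 < p -> 0 <= atom_const p.
Proof.
move=> p0; have b1 : 1 < 2 `^ p :> R by exact: powR2_gt1.
rewrite addr_ge0 ?powR_ge0 // !mulr_ge0 ?powR_ge0 // invr_ge0 subr_ge0; exact: ltW.
Qed.

(** With [M_K <= n < M_(K+1)] the number of outer levels is [K + 1 - N], and
    [2^(K - N) M_N <= M_K <= n] turns it into a power of [n / M_N]. The exponent [r] stays free and
    is chosen later to keep the series in [n] convergent. *)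
Lemma atom_mean_growth q L N x0 u (g : X -> R[i]) n p r :
  (forall k, 0 <= q k) -> 0 < q 0%N -> (forall i j, (i <= j)%N -> q j <= q i) ->
  (N <= L)%N -> atom L N x0 u g -> 0 < p <= 1 -> 0 < r -> (M N < n <= M L)%N ->
  av L (fun x => normc (av_mean q L n g x) `^ p) <= atom_const p *
  (u `^ p * ((M N)%:R^-1 + (q (M N) / Qsum q n) `^ p * ((M N)%:R `^ (- p) *
    \sum_(s < N) (M s)%:R `^ (2 * p - 1)
     + (1 + (r * ln 2)^-1) * (n%:R / (M N)%:R) `^ r * (M N)%:R `^ (p - 1)))).
Proof.
move=> q0 q1 qd NL ga hp r0 /andP[Nn nL].
have n0 : (0 < n)%N by rewrite (leq_ltn_trans _ Nn).
have [K /andP[K1 K2]] := bigM_bracket m_ge2 n0.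
have KL : (K <= L)%N by apply: (leq_bigM_exp m_ge2); exact: leq_trans nL.
have NK : (N <= K)%N.
  by rewrite -ltnS; rewrite ltnNge; apply/negP => /(leq_bigM m_ge2); rewrite leqNgt (ltn_trans Nn).
apply: le_trans (atom_mean_powR m_ge2 m_le q0 q1 qd NL ga hp Nn K2 _ nL) _ => //.
apply: ler_wpM2l; first by apply: atom_const_ge0; case/andP: hp.
rewrite ler_wpM2l ?powR_ge0 // lerD2l ler_wpM2l ?powR_ge0 // lerD2l.
rewrite ler_wpM2r ?powR_ge0 // subSn //; apply: succ_le_powR => //.
rewrite ler_pdivlMr ?ltr0n ?bigM_gt0 // -natrX -natrM ler_nat.
by apply: leq_trans K1; rewrite -[in X in (_ <= M X)%N](subnKC NK) double_bigM_exp.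
Qed.

(** The means vanish up to [M_N], so only later indices are charged; for [K < M_N] nothing is left,
    which the Boolean factor records. *)
Lemma weighted_atom_sum_le q L N x0 u (g : X -> R[i]) p (w a : nat -> R) K :
  p != 0 -> atom L N x0 u g ->
  (forall n, 0 <= w n) ->
  (forall n, (M N < n <= K)%N -> av L (fun x => normc (av_mean q L n g x) `^ p) <= a n) ->
  \sum_(0 <= n < K) w n.+1 * av L (fun x => normc (av_mean q L n.+1 g x) `^ p) <=
  (M N <= K)%:R * \sum_(M N <= n < K) w n.+1 * a n.+1.
Proof.
move=> p0 ga w0 ha.
have v0 n : (n <= M N)%N -> av L (fun x => normc (av_mean q L n g x) `^ p) = 0.
  move=> nN; under eq_av do rewrite (atom_mean0 q ga _ nN) ComplexField.Normc.normc0 powR0 //.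
  by rewrite av_cst.
have [NK|KN] := leqP (M N) K; last first.
  rewrite mul0r big_nat_cond big1 // => n; rewrite andbT => /andP[_ nK].
  by rewrite v0 ?mulr0 // ltnW // (leq_ltn_trans nK).
rewrite mul1r (big_cat_nat (n := M N)) //= [X in X + _]big_nat_cond [X in X + _]big1 ?add0r.
  apply: ler_sum_nat => n /andP[Nn nK]; rewrite ler_wpM2l // ha //.
  by rewrite ltnS Nn.
by move=> n; rewrite andbT => /andP[_ nN]; rewrite v0 ?mulr0.
Qed.

(** The main term off the support is [M_N^(-2p)] for every [n > M_N]: one factor [M_N^(-p)] is in
    the kernel, the other comes from [q (M_N) / Q_n <= 1 / M_N]. The tail of the weights is of order
    [M_N^(2p-1)], so the product is exactly [1 / M_N]. *)
Lemma sum_atom_small p : 0 < p < 2^-1 -> exists2 C : R, 0 <= C &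
  forall q L N x0 u (g : X -> R[i]) K,
  (forall k, 0 <= q k) -> 0 < q 0%N -> (forall i j, (i <= j)%N -> q j <= q i) ->
  (N <= L)%N -> atom L N x0 u g -> (K <= M L)%N ->
  \sum_(0 <= n < K) (n.+1%:R `^ (2 - 2 * p))^-1 *
     av L (fun x => normc (av_mean q L n.+1 g x) `^ p) <= C * (u `^ p / (M N)%:R).
Proof.
move=> /andP[p0 p2].
(* Now [2 - 2p = 1 + 2r] and [2p - 1 = -2r]; spending one [r] on the number of levels still leaves
   the summable exponent [1 + r]. *)
pose r := 2^-1 - p; have r0 : 0 < r by rewrite subr_gt0.
have b1 : 1 < 2 `^ (2 * r) :> R by rewrite powR2_gt1 // mulr_gt0.
pose Zc := 2 `^ (2 * r) / (2 `^ (2 * r) - 1) : R.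
have Zc0 : 0 <= Zc by rewrite divr_ge0 ?powR_ge0 // subr_ge0 ltW.
pose Cr := 1 + (r * ln 2)^-1.
have l2 : 0 < ln 2 :> R by rewrite ln_gt0 // ltr1n.
have Cr0 : 0 <= Cr by rewrite addr_ge0 // invr_ge0 mulr_ge0 // ltW.
have hp : 0 < p <= 1 by rewrite p0 (le_trans (ltW p2)) // invf_le1 // ler1n.
have A0 := atom_const_ge0 p0.
have r20 : 0 < 2 * r by rewrite mulr_gt0.
have ri0 : 0 <= r^-1 by rewrite invr_ge0 ltW.
have ri20 : 0 <= (2 * r)^-1 by rewrite invr_ge0 ltW.
exists (atom_const p * ((2 * r)^-1 * (1 + Zc) + Cr / r)).
  by rewrite mulr_ge0 // addr_ge0 ?mulr_ge0 // addr_ge0.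
move=> q L N x0 u g K q0 q1 qd NL ga KL.
have Mp s : 0 < (M s)%:R :> R by rewrite ltr0n bigM_gt0.
have Mn s : (M s)%:R != 0 :> R by rewrite gt_eqF.
have Z1 : \sum_(s < N) (M s)%:R `^ (2 * p - 1) <= Zc :> R.
  apply: le_trans (sum_geom_decreasing (a := fun s => (M s)%:R `^ (2 * p - 1)) b1 _ _ N) _; last first.
  - by rewrite bigM0 powR1 mulr1.
  - move=> s.
    have -> : 2 * p - 1 = - (2 * r) by rewrite /r; field.
    rewrite !powRN ler_pdivrMr ?powR_gt0 // [leRHS]mulrC ler_pdivlMr ?powR_gt0 //.
    rewrite -powRM ?ler0n // ge0_ler_powR ?nnegrE ?(ltW r20) ?ler0n ?mulr_ge0 //.
    by rewrite -natrM ler_nat leq_double_bigM.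
  - by move=> s; exact: powR_ge0.
set MN := (M N)%:R : R.
have EV s : MN `^ (- s) = MN^-1 `^ s by rewrite -powR_inv1 ?ler0n // -powRrM mulN1r.
pose a n := atom_const p * (u `^ p * (MN^-1 + MN `^ (- p) * (MN `^ (- p) * Zc + Cr * (n%:R `^ r * MN `^ (- r)) * MN `^ (p - 1)))).
have ha n : (M N < n <= K)%N -> av L (fun x => normc (av_mean q L n g x) `^ p) <= a n.
  move=> /andP[Nn nK].
  have Q0 : 0 < Qsum q n by rewrite Qsum_gt0 // (leq_ltn_trans _ Nn).
  apply: le_trans (atom_mean_growth q0 q1 qd NL ga hp r0 _) _.
    by rewrite Nn (leq_trans nK).
  rewrite ler_wpM2l // ler_wpM2l ?powR_ge0 // lerD2l ler_pM ?powR_ge0 //.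
  - by rewrite addr_ge0 ?mulr_ge0 ?powR_ge0 // sumr_ge0 // => s _; rewrite powR_ge0.
  - rewrite EV ge0_ler_powR ?nnegrE ?(ltW p0) //.
    + by rewrite divr_ge0 // ltW.
    + by rewrite invr_ge0 ler0n.
    + have hQ : MN * q (M N) <= Qsum q n := le_Qsum q0 qd (ltnW Nn).
      have MN0 : 0 < MN by exact: Mp.
      by rewrite ler_pdivrMr // ler_pdivlMl.
  - rewrite lerD ?ler_wpM2l ?powR_ge0 // powRM ?invr_ge0 ?ler0n //.
    by rewrite EV.
apply: le_trans (weighted_atom_sum_le (w := fun n => (n%:R `^ (2 - 2 * p))^-1) _ ga _ ha) _; first by rewrite gt_eqF.
  by move=> n; rewrite invr_ge0 powR_ge0.
have [NK|_] := leqP (M N) K; last by rewrite mul0r !mulr_ge0 ?powR_ge0 ?invr_ge0 ?ler0n // addr_ge0 // ?mulr_ge0 // addr_ge0.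
have -> : (true%:R : R) * \sum_(M N <= n < K) (n.+1%:R `^ (2 - 2 * p))^-1 * a n.+1 =
   atom_const p * u `^ p * ((MN^-1 + MN `^ (- p) * MN `^ (- p) * Zc) *
      (\sum_(M N <= n < K) n.+1%:R `^ (- (1 + 2 * r)))
    + Cr * (MN `^ (- p) * MN `^ (p - 1) * MN `^ (- r)) * \sum_(M N <= n < K) n.+1%:R `^ (- (1 + r))).
  rewrite mul1r !mulr_sumr -big_split mulr_sumr; apply: eq_bigr => n _ /=.
  have n0 : (n.+1%:R : R) != 0 by rewrite pnatr_eq0.
  have -> : n.+1%:R `^ (- (1 + r)) = n.+1%:R `^ r * n.+1%:R `^ (- (1 + 2 * r)) :> R.
    by rewrite -powRD ?n0 ?implybT //; congr (_ `^ _); ring.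
  have -> : (n.+1%:R `^ (2 - 2 * p))^-1 = n.+1%:R `^ (- (1 + 2 * r)) :> R.
    by rewrite -powRN; congr (_ `^ _); rewrite /r; field.
  by rewrite /a; ring.
have N1 : (0 < M N)%N by rewrite bigM_gt0.
have T1 := tail_sum r20 N1 NK; have T2 := tail_sum r0 N1 NK.
rewrite -/MN in T1 T2.
have E1 : MN `^ (- p) * MN `^ (- p) * MN `^ (- (2 * r)) = MN^-1.
  by rewrite -!powRD ?Mn ?implybT // -powR_inv1 ?ler0n //; congr (_ `^ _); rewrite /r; field.
have E2 : MN `^ (- p) * MN `^ (p - 1) = MN^-1.
  by rewrite -!powRD ?Mn ?implybT // -powR_inv1 ?ler0n //; congr (_ `^ _); ring.
have L1 s : 0 <= s -> MN `^ (- s) <= 1.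
  by move=> s0; rewrite -[leRHS](powRr0 MN) ler_powR ?oppr_le0 // ler1n bigM_gt0.
rewrite -mulrA [leRHS](_ : _ = atom_const p * (u `^ p * (MN^-1 * ((2 * r)^-1 * (1 + Zc) + Cr / r)))); last by rewrite -/MN; ring.
rewrite ler_wpM2l // ler_wpM2l ?powR_ge0 // [leRHS]mulrDr lerD //.
  apply: le_trans (ler_wpM2l _ T1) _.
    by rewrite addr_ge0 ?invr_ge0 ?ler0n // mulr_ge0 // mulr_ge0 ?powR_ge0.
  rewrite [leLHS](_ : _ = (2 * r)^-1 * (MN^-1 * MN `^ (- (2 * r)))
    + (2 * r)^-1 * Zc * (MN `^ (- p) * MN `^ (- p) * MN `^ (- (2 * r)))); last by ring.
  rewrite E1 [leRHS](_ : _ = (2 * r)^-1 * MN^-1 + (2 * r)^-1 * Zc * MN^-1); last by ring.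
  by rewrite lerD2r ler_wpM2l // ler_piMr ?invr_ge0 ?ler0n // L1 // ltW.
rewrite E2; apply: le_trans (ler_wpM2l _ T2) _.
  by rewrite !mulr_ge0 ?powR_ge0 ?invr_ge0 ?ler0n.
rewrite [leLHS](_ : _ = MN^-1 * (Cr / r) * (MN `^ (- r) * MN `^ (- r))); last by ring.
rewrite ler_piMr ?mulr_ge0 ?invr_ge0 ?ler0n ?(ltW r0) //.
by rewrite mulr_ile1 ?powR_ge0 // L1 // ltW.
Qed.

(** The bound [D / n] on the ratio adds the decay [n^(-1/2)], so off the support the sum over
    [n > M_N] is of order [1 / M_N] times [N] plus a constant. The logarithm comes from this [N] and
    from the harmonic sum on the support. *)
Lemma sum_atom_half (D : R) : 0 <= D -> exists2 C : R, 0 <= C &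
  forall q L N x0 u (g : X -> R[i]) K,
  (forall k, 0 <= q k) -> 0 < q 0%N -> (forall i j, (i <= j)%N -> q j <= q i) ->
  (forall k n, (0 < n)%N -> q k / Qsum q n <= D / n%:R) ->
  (N <= L)%N -> atom L N x0 u g -> (0 < K <= M L)%N ->
  \sum_(0 <= n < K) n.+1%:R^-1 *
     av L (fun x => normc (av_mean q L n.+1 g x) `^ 2^-1)
    <= C * (1 + ln K%:R) * (u `^ 2^-1 / (M N)%:R).
Proof.
move=> D0; set p : R := 2^-1.
(* Half of [p]: the exponent [1 + p - r] of the series in [n] equals [1 + r]. *)
pose r : R := 4^-1; have r0 : 0 < r by rewrite invr_gt0.
pose Cr := 1 + (r * ln 2)^-1.
have l2 : 0 < ln 2 :> R by rewrite ln_gt0 // ltr1n.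
have Cr0 : 0 <= Cr by rewrite addr_ge0 // invr_ge0 mulr_ge0 // ltW.
have p0 : 0 < p by rewrite invr_gt0.
have hp : 0 < p <= 1 by rewrite p0 invf_le1 // ler1n.
have A0 := atom_const_ge0 p0.
have li0 : 0 <= (ln 2)^-1 :> R by rewrite invr_ge0 ltW.
have Dp0 := powR_ge0 D p.
have CC0 : 0 <= atom_const p * (1 + D `^ p * (2 * (ln 2)^-1 + 4 * Cr)).
  by rewrite mulr_ge0 // addr_ge0 // mulr_ge0 // addr_ge0 // mulr_ge0.
exists (atom_const p * (1 + D `^ p * (2 * (ln 2)^-1 + 4 * Cr))) => //.
move=> q L N x0 u g K q0 q1 qd qD NL ga /andP[K0 KL].
have lK : 0 <= ln K%:R :> R by rewrite ln_ge0 // ler1n.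
set MN := (M N)%:R : R.
have MN0 : 0 < MN by rewrite ltr0n bigM_gt0.
have Mn : MN != 0 by rewrite gt_eqF.
have MNi0 : 0 <= MN^-1 by rewrite invr_ge0 ltW.
have EV s : MN `^ (- s) = MN^-1 `^ s by rewrite -powR_inv1 ?ler0n // -powRrM mulN1r.
pose a n := atom_const p * (u `^ p * (MN^-1 + (D `^ p * n%:R `^ (- p)) * (MN `^ (- p) * N%:R + Cr * (n%:R `^ r * MN `^ (- r)) * MN `^ (p - 1)))).
have ha n : (M N < n <= K)%N -> av L (fun x => normc (av_mean q L n g x) `^ p) <= a n.
  move=> /andP[Nn nK]; have n0 : (0 < n)%N by rewrite (leq_ltn_trans _ Nn).
  have Q0 : 0 < Qsum q n by rewrite Qsum_gt0.
  apply: le_trans (atom_mean_growth q0 q1 qd NL ga hp r0 _) _.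
    by rewrite Nn (leq_trans nK).
  rewrite ler_wpM2l // ler_wpM2l ?powR_ge0 // lerD2l ler_pM ?powR_ge0 //.
  - by rewrite addr_ge0 ?mulr_ge0 ?powR_ge0 // sumr_ge0 // => s _; rewrite powR_ge0.
  - have -> : D `^ p * n%:R `^ (- p) = (D / n%:R) `^ p.
      by rewrite powRM ?invr_ge0 ?ler0n // -powR_inv1 ?ler0n // -powRrM mulN1r.
    rewrite ge0_ler_powR ?nnegrE ?(ltW p0) //; last exact: qD.
      by rewrite divr_ge0 // ltW.
    by rewrite divr_ge0.
  - rewrite lerD ?ler_wpM2l ?powR_ge0 //.
      have -> : 2 * p - 1 = 0 by rewrite /p; field.
      under eq_bigr do rewrite powRr0.
      by rewrite sumr_const card_ord.
    by rewrite powRM ?invr_ge0 ?ler0n // EV.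
apply: le_trans (weighted_atom_sum_le (w := fun n => n%:R^-1) _ ga _ ha) _; first by rewrite gt_eqF.
  by move=> n; rewrite invr_ge0.
have C0 : 0 <= atom_const p * (1 + D `^ p * (2 * (ln 2)^-1 + 4 * Cr)) * (1 + ln K%:R) * (u `^ p / MN).
  rewrite mulr_ge0 //; last by rewrite mulr_ge0 ?powR_ge0.
  by rewrite mulr_ge0 // addr_ge0.
have [NK|_] := leqP (M N) K; last by rewrite mul0r.
have -> : (true%:R : R) * \sum_(M N <= n < K) n.+1%:R^-1 * a n.+1 =
   atom_const p * u `^ p * (MN^-1 * (\sum_(M N <= n < K) n.+1%:R^-1)
    + (D `^ p * (MN `^ (- p) * N%:R)) * (\sum_(M N <= n < K) n.+1%:R `^ (- (1 + p)))
    + (D `^ p * (Cr * (MN `^ (p - 1) * MN `^ (- r)))) * \sum_(M N <= n < K) n.+1%:R `^ (- (1 + r))).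
  rewrite mul1r !mulr_sumr -!big_split mulr_sumr; apply: eq_bigr => n _ /=.
  have n0 : (n.+1%:R : R) != 0 by rewrite pnatr_eq0.
  have -> : n.+1%:R `^ (- (1 + r)) = n.+1%:R^-1 * (n.+1%:R `^ (- p) * n.+1%:R `^ r) :> R.
    by rewrite -powR_inv1 // -!powRD ?n0 ?implybT //; congr (_ `^ _); rewrite /p /r; field.
  have -> : n.+1%:R `^ (- (1 + p)) = n.+1%:R^-1 * n.+1%:R `^ (- p) :> R.
    by rewrite -powR_inv1 // -!powRD ?n0 ?implybT //; congr (_ `^ _); ring.
  by rewrite /a; ring.
have N1 : (0 < M N)%N by rewrite bigM_gt0.
have T1 := tail_sum p0 N1 NK; have T2 := tail_sum r0 N1 NK.
rewrite -/MN in T1 T2.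
have T0 : \sum_(M N <= n < K) (n.+1%:R^-1 : R) <= 1 + ln K%:R.
  apply: le_trans (harmonic_le_ln _ K0); rewrite big_add1 /=.
  by rewrite [leRHS](big_cat_nat (n := M N)) //= lerDr sumr_ge0 // => n _; rewrite invr_ge0.
have E1 : MN `^ (- p) * MN `^ (- p) = MN^-1.
  by rewrite -powRD ?Mn ?implybT // -powR_inv1 ?ler0n //; congr (_ `^ _); rewrite /p; field.
have E2 : MN `^ (p - 1) * MN `^ (- r) * MN `^ (- r) = MN^-1.
  by rewrite -!powRD ?Mn ?implybT // -powR_inv1 ?ler0n //; congr (_ `^ _); rewrite /p /r; field.
(* Only atoms with [M_N <= K] remain, and [2^N <= M_N]. *)
have NlnK : N%:R <= (ln 2)^-1 * ln K%:R :> R.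
  rewrite ler_pdivlMl // mulr_natr -lnXn // ler_ln ?posrE ?ltr0n ?exprn_gt0 //.
  by rewrite -natrX ler_nat (leq_trans (expn2_bigM m_ge2 N)).
rewrite [leRHS](_ : _ = atom_const p * u `^ p * (MN^-1 * ((1 + ln K%:R) * (1 + D `^ p * (2 * (ln 2)^-1 + 4 * Cr))))); last by ring.
apply: ler_wpM2l; first by rewrite mulr_ge0 ?powR_ge0.
have S1 : (D `^ p * (MN `^ (- p) * N%:R)) * (\sum_(M N <= n < K) n.+1%:R `^ (- (1 + p))) <=
    MN^-1 * (D `^ p * (2 * ((ln 2)^-1 * ln K%:R))).
  apply: le_trans (ler_wpM2l _ T1) _; first by rewrite !mulr_ge0 ?powR_ge0.
  rewrite [leLHS](_ : _ = (MN `^ (- p) * MN `^ (- p)) * (D `^ p * (p^-1 * N%:R))); last by ring.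
  by rewrite E1 invrK ler_wpM2l // ler_wpM2l // ler_wpM2l.
have S2 : (D `^ p * (Cr * (MN `^ (p - 1) * MN `^ (- r)))) * (\sum_(M N <= n < K) n.+1%:R `^ (- (1 + r))) <=
    MN^-1 * (D `^ p * (4 * Cr)).
  apply: le_trans (ler_wpM2l _ T2) _; first by rewrite !mulr_ge0 ?powR_ge0.
  rewrite [leLHS](_ : _ = (MN `^ (p - 1) * MN `^ (- r) * MN `^ (- r)) * (D `^ p * (r^-1 * Cr))); last by ring.
  by rewrite E2 invrK.
apply: le_trans (lerD (lerD (ler_wpM2l MNi0 T0) S1) S2) _.
rewrite -!mulrDr ler_wpM2l //.
have h1 : 0 <= D `^ p * (2 * (ln 2)^-1) by rewrite !mulr_ge0.
have h2 : 0 <= D `^ p * (4 * Cr) * ln K%:R by rewrite !mulr_ge0.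
rewrite -subr_ge0 [X in 0 <= X](_ : _ = D `^ p * (2 * (ln 2)^-1) + D `^ p * (4 * Cr) * ln K%:R); first exact: addr_ge0.
ring.
Qed.

End AtomSums.

(** * Atomic decomposition at a finite level *)

Section AveragingOperator.
Variable m : nat -> nat.
Hypothesis m_ge2 : forall k, (2 <= m k)%N.
Local Notation M := (bigM m).
Local Notation X := (vilenkin m).

(** The inner factor is the conditional expectation of [g] at level [n]. Exchanging the averages
    moves it onto [h], which it leaves unchanged. *)
Lemma av_cond_exp (V : numFieldType) L n (h g : X -> V) : (n <= L)%N -> level n h ->
  av L (fun x => h x * ((M n)%:R * av L (fun t => g t * (agree n x t)%:R))) =
  av L (fun t => h t * g t).
Proof.
move=> nL hn.
transitivity (av L (fun x => av L (fun t => (h t * g t * (M n)%:R) * (agree n t x)%:R))).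
  apply: eq_av => x; rewrite mulrA -avZ; apply: eq_av => t.
  rewrite [agree n t x]agree_sym; case: (boolP (agree n x t)) => [/hn ->|_]; last by rewrite !mulr0.
  by rewrite !mulr1 mulrAC.
rewrite av_exchange; apply: eq_av => t; rewrite avZ av_cyl // -mulrA divff ?mulr1 //.
exact: natM_neq0.
Qed.

Lemma agree_level n (x : X) : level n (agree n x).
Proof. by move=> t t' /agree_congr tt'; rewrite agree_sym tt' agree_sym. Qed.

End AveragingOperator.

Section Decomposition.
Variables (R : realType) (m : nat -> nat) (B : nat).
Hypothesis m_ge2 : forall k, (2 <= m k)%N.
Hypothesis m_le : forall k, (m k <= B)%N.
Local Notation M := (bigM m).
Local Notation X := (vilenkin m).
Variables (L : nat) (f : nat -> X -> R[i]).
Hypothesis f_level : forall n, level n (f n).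
Hypothesis f_mart : forall n x, (n <= L)%N ->
  f n x = (M n)%:R * av L (fun t => f L t * (agree n x t)%:R).

Lemma mart_av n (h : X -> R[i]) : (n <= L)%N -> level n h ->
  av L (fun x => h x * f n x) = av L (fun x => h x * f L x).
Proof.
move=> nL hn; under eq_av do rewrite f_mart //.
exact: av_cond_exp.
Qed.

Lemma mart_av_diff n (h : X -> R[i]) : (n < L)%N -> level n h ->
  av L (fun x => h x * (f n.+1 x - f n x)) = 0.
Proof.
move=> nL hn; under eq_av do rewrite mulrBr.
rewrite avB !mart_av ?subrr //; first exact: ltnW.
by apply: levelW hn.
Qed.

(** [f n] at [x] is the mean of [f n.+1] over the cylinder of level [n], so a bound one level ahead
    descends. *)
Lemma normc_mart_le n x c : (n < L)%N ->
  (forall y, agree n x y -> normc (f n.+1 y) <= c) -> normc (f n x) <= c.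
Proof.
move=> nL hc.
have -> : f n x = (M n)%:R * av L (fun t => (agree n x t)%:R * f n.+1 t).
  rewrite (mart_av nL); last by apply: (levelW (leqnSn n)) => t t' /(@agree_level _ n x) ->.
  by rewrite f_mart 1?ltnW //; congr (_ * _); apply: eq_av => t; rewrite mulrC.
rewrite ComplexField.Normc.normcM normc_nat.
apply: le_trans (ler_wpM2l (ler0n _ _) (normc_av m_ge2 _ _)) _.
apply: le_trans (_ : (M n)%:R * av L (fun t => c * (agree n x t)%:R) <= _).
  rewrite ler_wpM2l //; apply: av_le => // t.
  rewrite ComplexField.Normc.normcM normc_nat mulrC.
  by case: (boolP (agree n x t)) => [/hc h|_]; rewrite ?mulr0 // !mulr1.
by rewrite avZ av_cyl ?(ltnW nL) // mulrCA divff ?mulr1 // natM_neq0.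
Qed.

(* Looking one level ahead: if [exceeds c n x] fails then [f n.+1] is still
   bounded by [c] on the cylinder of level [n] at [x], so stopped martingales
   have no overshoot.  The price is the factor [B] in [av_first_exceeds]. *)
Definition exceeds (c : R) n x : bool :=
  [exists j : 'I_n.+1, [exists i : 'I_(M L), agree j (pt m i) x && (c < normc (f j.+1 (pt m i)))]].

Lemma exceedsP c n x : (n < L)%N ->
  reflect (exists j y, [/\ (j <= n)%N, agree j y x & c < normc (f j.+1 y)]) (exceeds c n x).
Proof.
move=> nL; apply: (iffP existsP) => [[j /existsP[i /andP[h1 h2]]]|[j [y [jn jy cy]]]].
  by exists j, (pt m i); rewrite -ltnS ltn_ord.
have [i iM iy] := pt_agree_ex m_ge2 L y.
exists (Ordinal (jn : (j < n.+1)%N)); apply/existsP; exists (Ordinal iM) => /=.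
have jL : (j < L)%N by rewrite (leq_ltn_trans jn).
rewrite (agree_congr _ (agreeW (ltnW jL) iy)) jy.
by rewrite (f_level (agreeW jL iy)).
Qed.

Lemma exceeds_mono c n n' x : (n <= n')%N -> (n' < L)%N -> exceeds c n x -> exceeds c n' x.
Proof.
move=> nn' n'L /exceedsP -/(_ (leq_ltn_trans nn' n'L))[j [y [jn jy cy]]].
by apply/exceedsP => //; exists j, y; rewrite (leq_trans jn).
Qed.

Lemma exceedsW c c' n x : (n < L)%N -> c <= c' -> exceeds c' n x -> exceeds c n x.
Proof.
move=> nL cc' /exceedsP -/(_ nL)[j [y [jn jy cy]]].
by apply/exceedsP => //; exists j, y; rewrite (le_lt_trans cc').
Qed.

Lemma exceeds_level c n : (n < L)%N -> level n (exceeds c n).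
Proof.
move=> nL x y xy; apply/exceedsP/exceedsP => // -[j [z [jn jz cz]]]; exists j, z; split => //;
  apply: (agree_trans jz); apply: (agreeW jn) => //; by rewrite agree_sym.
Qed.

Lemma not_exceeds c n x : (n < L)%N -> ~~ exceeds c n x ->
  normc (f n.+1 x) <= c /\ normc (f n x) <= c.
Proof.
move=> nL h.
have H y : agree n x y -> normc (f n.+1 y) <= c.
  move=> xy; rewrite leNgt; apply: contra h => cy.
  by apply/exceedsP => //; exists n, y; rewrite agree_sym.
by split; [apply: H; exact: agree_refl|exact: normc_mart_le].
Qed.

Definition stopped c l x := \sum_(n < l) (~~ exceeds c n x)%:R * (f n.+1 x - f n x).

(** Before the exit the sum telescopes to [f l - f 0], both terms at most [c] thanks to the
    look-ahead; after the exit it is frozen. The telescoped form is carried through the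
    induction. *)
Lemma normc_stopped_le c l x : 0 <= c -> (l <= L)%N -> normc (stopped c l x) <= 2 * c.
Proof.
move=> c0 lL.
suff [] : normc (stopped c l x) <= 2 * c /\
    ((forall n, (n < l)%N -> ~~ exceeds c n x) -> stopped c l x = f l x - f 0%N x) by [].
elim: l lL => [|l IH] lL.
  by rewrite /stopped big_ord0 ComplexField.Normc.normc0 mulr_ge0 // subrr.
have [IH1 IH2] := IH (ltnW lL).
rewrite /stopped big_ord_recr /= -/(stopped c l x).
case: (boolP (exceeds c l x)) => hl /=.
  rewrite mul0r addr0; split => // /(_ l (leqnn _)); by rewrite hl.
have hall n : (n < l)%N -> ~~ exceeds c n x.
  by move=> nl; apply: contra hl; apply: exceeds_mono => //; exact: ltnW.
have E : stopped c l x + true%:R * (f l.+1 x - f l x) = f l.+1 x - f 0%N x.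
  by rewrite (IH2 hall) mul1r addrC addrA subrK.
rewrite E; split => //.
apply: le_trans (normcD _ _) _; rewrite mulr2n mulrDl mul1r lerD //.
  by have [] := not_exceeds lL hl.
have h0 : ~~ exceeds c 0%N x by case: (l) hl hall => // l' _ /(_ 0%N isT).
rewrite normc_opp.
by have [] := not_exceeds (leq_ltn_trans (leq0n l) lL) h0.
Qed.

(** [exceeds] is monotone in the level, so one preceding level suffices. Level 0 is exempted because
    there [N.-1] is 0 again. *)
Definition first_exceeds c N x := exceeds c N x && ((N == 0%N) || ~~ exceeds c N.-1 x).

Lemma first_exceeds_level c N : (N < L)%N -> level N (first_exceeds c N).
Proof.
move=> NL x y xy; rewrite /first_exceeds (exceeds_level _ NL xy).
case: N NL xy => // N NL xy /=.
by rewrite (exceeds_level _ (ltnW NL) (agreeW (leqnSn _) xy)).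
Qed.

Lemma sum_first_exceeds (V : pzRingType) c l x : (l < L)%N ->
  \sum_(N < l.+1) (first_exceeds c N x)%:R = (exceeds c l x)%:R :> V.
Proof.
elim: l => [|l IH] lL; first by rewrite big_ord_recl big_ord0 addr0 /first_exceeds eqxx andbT.
rewrite big_ord_recr /= IH ?(ltnW lL) // /first_exceeds /=.
case: (boolP (exceeds c l x)) => h; last by rewrite andbT add0r.
by rewrite andbF addr0 (exceeds_mono (leqnSn l) lL h).
Qed.

Lemma sum_first_exceeds_le c x : \sum_(N < L) (first_exceeds c N x)%:R <= 1 :> R.
Proof.
case: L (@sum_first_exceeds R c) => [|l] h; first by rewrite big_ord0.
by rewrite h //; case: exceeds.
Qed.

(** Regularity of the filtration: inside a cylinder of level [N] where the first exit occurs, some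
    subcylinder of level [N.+1] has [f N.+1] above [c], and it fills at least a [1 / B] part. *)
Lemma av_first_exceeds c N : (N < L)%N ->
  av L (fun x => (first_exceeds c N x)%:R) <=
  B%:R * av L (fun x => (first_exceeds c N x)%:R * (c < normc (f N.+1 x))%R%:R) :> R.
Proof.
move=> NL; pose g t : R := (c < normc (f N.+1 t))%R%:R.
have hlev : level N (fun x => (first_exceeds c N x)%:R : R).
  by move=> x y /(first_exceeds_level c NL) ->.
rewrite -(av_cond_exp m_ge2 g (ltnW NL) hlev) -avZ; apply: av_le => // x.
case: (boolP (first_exceeds c N x)) => h; last by rewrite mul0r mulr0.
rewrite mul1r; case/andP: h => /exceedsP -/(_ NL)[j [y [jN jy cy]]] hN.
(* A witness at an earlier level would contradict that the exit at [N] is the first. *)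
have {jN} jN : j = N.
  apply/eqP; rewrite eqn_leq jN leqNgt; apply/negP => jN'.
  case: N NL hN jN jN' {g hlev} => // N NL /= hN jN jN'; case/negP: hN.
  by apply/exceedsP; [exact: ltnW|exists j, y].
subst j.
apply: le_trans (_ : B%:R * ((M N)%:R * av L (fun t => (agree N.+1 y t)%:R)) <= _).
  have mN0 : (m N)%:R != 0 :> R by rewrite pnatr_eq0 -lt0n m_gt0.
  rewrite av_cyl // bigMS natrM [X in _ * X](_ : _ = (m N)%:R^-1); last first.
    by field; rewrite natM_neq0 // mN0.
  by rewrite ler_pdivlMr ?mul1r ?natm_le // ltr0n m_gt0.
rewrite ler_wpM2l // ler_wpM2l //; apply: av_le => // t.
case: (boolP (agree N.+1 y t)) => h; last by rewrite mulr_ge0.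
rewrite /g -(f_level h) cy mul1r; rewrite agree_sym in jy.
by rewrite (agree_trans jy) // (agreeW (leqnSn N)).
Qed.

Definition layer c c' x := stopped c' L x - stopped c L x.

Lemma normc_layer_le c x : 0 <= c -> normc (layer c (2 * c) x) <= 6 * c.
Proof.
move=> c0; apply: le_trans (normcD _ _) _.
rewrite normc_opp.
have := normc_stopped_le x (mulr_ge0 (ler0n R 2) c0) (leqnn L).
have := normc_stopped_le x c0 (leqnn L).
lra.
Qed.

Lemma layerE c c' x : layer c c' x =
  \sum_(n < L) ((~~ exceeds c' n x)%:R - (~~ exceeds c n x)%:R) * (f n.+1 x - f n x).
Proof. by rewrite /layer /stopped -sumrB; apply: eq_bigr => n _; rewrite mulrBl. Qed.

Lemma layer0 c c' x : c <= c' -> (forall n, (n < L)%N -> ~~ exceeds c n x) -> layer c c' x = 0.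
Proof.
move=> cc' h; rewrite layerE big1 // => n _; rewrite h // (contra _ (h n (ltn_ord n))) ?subrr ?mul0r //.
exact: exceedsW.
Qed.

Definition layer_atom c c' N i x : R[i] :=
  (first_exceeds c N (pt m i))%:R * (agree N (pt m i) x)%:R * layer c c' x.

Lemma layer_atom_sum c c' x : c <= c' ->
  \sum_(N < L) \sum_(i < M N) layer_atom c c' N i x = layer c c' x.
Proof.
move=> cc'.
have -> : \sum_(N < L) \sum_(i < M N) layer_atom c c' N i x =
    (\sum_(N < L) (first_exceeds c N x)%:R) * layer c c' x.
  rewrite mulr_suml; apply: eq_bigr => N _.
  have hlev : level N (fun x => (first_exceeds c N x)%:R : R[i]).
    by move=> y z /(first_exceeds_level c (ltn_ord N)) ->.
  by rewrite (level_sum m_ge2 x hlev) mulr_suml; apply: eq_bigr.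
case: (posnP L) => [L0|L0].
  by rewrite layer0 ?mulr0 // => n; rewrite L0.
have hL : (L.-1 < L)%N by rewrite prednK.
have := @sum_first_exceeds R[i] c L.-1 x hL; rewrite prednK // => ->.
case: (boolP (exceeds c L.-1 x)) => h; first by rewrite mul1r.
rewrite layer0 ?mulr0 // => n nL; apply: contra h; apply: exceeds_mono => //.
by rewrite -ltnS prednK.
Qed.

(** Below level [N] neither threshold has been exceeded, so the two multipliers cancel. From [N] on,
    the multiplier times the conjugate of [psi j], [j < M N], depends on the first [n] coordinates
    and is orthogonal to the increment. The height is [6 c = 2 (2 c) + 2 c], and 0 on unselected
    cylinders. *)
Lemma layer_atomP c N i : 0 <= c -> (N < L)%N ->
  atom L N (pt m i) (6 * c * (first_exceeds c N (pt m i))%:R) (layer_atom c (2 * c) N i).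
Proof.
move=> c0 NL; split => [t|j jN].
  rewrite /layer_atom !ComplexField.Normc.normcM !normc_nat mulrC mulrA.
  by rewrite ler_wpM2r // ler_wpM2r // normc_layer_le.
have c2 : c <= 2 * c by rewrite ler_peMl // ler1n.
pose w n t : R[i] := (first_exceeds c N (pt m i))%:R * (agree N (pt m i) t)%:R *
  ((~~ exceeds (2 * c) n t)%:R - (~~ exceeds c n t)%:R) * (psi R j t)^*.
rewrite /av_coef (_ : av L _ = av L (fun t => \sum_(n < L) w n t * (f n.+1 t - f n t))); last first.
  apply: eq_av => t; rewrite /layer_atom layerE mulr_sumr mulr_suml; apply: eq_bigr => n _.
  by rewrite /w; ring.
rewrite av_sum big1 // => n _; apply: mart_av_diff => //.
have [Nn|nN] := leqP N n; last first.
  have w0 t : w n t = 0.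
    rewrite /w; case: (boolP (first_exceeds c N _)) => h1; last by rewrite !mul0r.
    case: (boolP (agree N (pt m i) t)) => h2; last by rewrite mulr0 !mul0r.
    have := h1; rewrite (first_exceeds_level c NL h2) => /andP[_ /orP[/eqP N0|h3]].
      by rewrite N0 in nN.
    have h4 : ~~ exceeds c n t.
      apply: contra h3; apply: exceeds_mono; last by rewrite (leq_ltn_trans (leq_pred N)).
      by rewrite -ltnS (ltn_predK nN).
    rewrite h4 (contra _ h4) ?subrr ?mulr0 ?mul0r //.
    exact: exceedsW.
  by move=> t t' _; rewrite !w0.
move=> t t' tt'; rewrite /w !(exceeds_level _ (ltn_ord n) tt').
rewrite (psi_level R m_ge2 jN (agreeW Nn tt')).
by rewrite (agree_level (pt m i) (agreeW Nn tt')).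
Qed.

End Decomposition.

(** * Gaps and bounds for finite sets of values *)

Section FiniteGap.
Variable R : realType.

Lemma seq_gap (s : seq R) : exists2 c, 0 < c & forall v, v \in s -> 0 < v -> c < v.
Proof.
elim: s => [|a s [c c0 hc]]; first by exists 1.
have [a0|a0] := ltP 0 a; last first.
  exists c => // v; rewrite inE => /predU1P[->|]; last exact: hc.
  by move=> /(le_lt_trans a0); rewrite ltxx.
exists (Num.min c (a / 2)); first by rewrite lt_min c0 divr_gt0.
move=> v; rewrite inE gt_min => /predU1P[->|vs] v0; last by rewrite hc.
by rewrite [a / 2 < a](_ : _ = true) ?orbT // ltr_pdivrMr // ltr_pMr // ltr1n.
Qed.

Lemma seq_ub (s : seq R) : exists b, forall v, v \in s -> v <= b.
Proof.
elim: s => [|a s [b hb]]; first by exists 0.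
exists (Num.max a b) => v; rewrite inE le_max => /predU1P[->|/hb ->]; first by rewrite lexx.
by rewrite orbT.
Qed.

Lemma exp2_unbounded (b c : R) : 0 < c -> exists k, b <= c * 2 ^+ k.
Proof.
move=> c0; have [b0|b0] := leP b 0.
  by exists 0%N; rewrite expr0 mulr1 (le_trans b0) // ltW.
have h := archi_boundP (divr_ge0 (ltW b0) (ltW c0)).
exists (Num.bound (b / c)); rewrite -ler_pdivrMl // mulrC (le_trans (ltW h)) //.
by rewrite -natrX ler_nat ltnW // ltn_expl.
Qed.

End FiniteGap.

(** * From atoms to martingales at a finite level *)

Section FiniteTheorem.
Variables (R : realType) (m : nat -> nat) (B : nat).
Hypothesis m_ge2 : forall k, (2 <= m k)%N.
Hypothesis m_le : forall k, (m k <= B)%N.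
Local Notation M := (bigM m).
Local Notation X := (vilenkin m).

Lemma av_mean_sum (I : Type) (s : seq I) (P : pred I) (F : I -> X -> R[i]) q L n x :
  av_mean q L n (fun t => \sum_(i <- s | P i) F i t) x =
  \sum_(i <- s | P i) av_mean q L n (F i) x.
Proof.
rewrite /av_mean -mulr_sumr; congr (_ * _).
rewrite exchange_big; apply: eq_bigr => k _ /=; rewrite -mulr_sumr; congr (_ * _).
rewrite partial_sum_av (eq_av L (h := fun t => \sum_(i <- s | P i) F i t * dirichlet R k x t)).
  by rewrite av_sum; apply: eq_bigr => i _; rewrite partial_sum_av.
by move=> t; rewrite mulr_suml.
Qed.

Lemma av_meanD g h q L n (x : X) :
  av_mean q L n (fun t => g t + h t) x = av_mean q L n g x + av_mean q L n h x :> R[i].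
Proof.
rewrite /av_mean -mulrDr; congr (_ * _); rewrite -big_split; apply: eq_bigr => k _ /=.
rewrite -mulrDr; congr (_ * _); rewrite !partial_sum_av -avD; apply: eq_av => t.
by rewrite mulrDl.
Qed.

Lemma eq_av_mean g h q L n (x : X) : g =1 h -> av_mean q L n g x = av_mean q L n h x :> R[i].
Proof. by move=> /funext ->. Qed.

Section Fixed.
Variables (L : nat) (f : nat -> X -> R[i]).
Hypothesis f_level : forall n, level n (f n).
Hypothesis f_mart : forall n x, (n <= L)%N ->
  f n x = (M n)%:R * av L (fun t => f L t * (agree n x t)%:R).

Definition max_fun x : R := \big[Num.max/0]_(n < L.+1) normc (f n x).

Lemma le_max_fun n x : (n <= L)%N -> normc (f n x) <= max_fun x.
Proof.
move=> nL; rewrite /max_fun.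
exact: (le_bigmax_cond 0 (fun n : 'I_L.+1 => normc (f n x)) (j := Ordinal (nL : (n < L.+1)%N))).
Qed.

Lemma max_fun_ge0 x : 0 <= max_fun x.
Proof. exact: le_trans (normc_ge0 _) (le_max_fun x (leqnn L)). Qed.

(* The lowest threshold lies below every nonzero value of the martingale, so
   that the decomposition has no remainder. *)
Lemma mart_gap : exists c K, [/\ 0 < c,
  forall n x, (n <= L)%N -> normc (f n x) <= c -> f n x = 0 &
  forall n x, (n <= L)%N -> normc (f n x) <= c * 2 ^+ K].
Proof.
pose s := [seq normc (f n (pt m i)) | n <- iota 0 L.+1, i <- iota 0 (M L)].
have ins n x : (n <= L)%N -> normc (f n x) \in s.
  move=> nL; have [i iM ix] := pt_agree_ex m_ge2 L x.
  rewrite -(f_level (agreeW nL ix)); apply: (allpairs_f (fun n i => normc (f n (pt m i))));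
  by rewrite mem_iota.
have [c c0 hc] := seq_gap s; have [b hb] := seq_ub s.
have [K hK] := exp2_unbounded b c0; exists c, K; split => // n x nL; last first.
  exact: le_trans (hb _ (ins n x nL)) hK.
move=> h; apply: ComplexField.Normc.eq0_normc; apply/eqP; rewrite eq_le normc_ge0 andbT leNgt.
by apply/negP => /(hc _ (ins n x nL)); rewrite ltNge h.
Qed.

Lemma mart_decomp : exists c K, 0 < c /\ forall x, f L x = f 0%N x +
  \sum_(k < K) \sum_(N < L) \sum_(i < M N)
    layer_atom L f (c * 2 ^+ k) (2 * (c * 2 ^+ k)) N i x.
Proof.
have [c [K [c0 h1 h2]]] := mart_gap; exists c, K; split => // x.
have -> : \sum_(k < K) \sum_(N < L) \sum_(i < M N)
    layer_atom L f (c * 2 ^+ k) (2 * (c * 2 ^+ k)) N i x =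
    \sum_(0 <= k < K) (stopped L f (c * 2 ^+ k.+1) L x - stopped L f (c * 2 ^+ k) L x).
  rewrite big_mkord; apply: eq_bigr => k _; rewrite layer_atom_sum //.
    by rewrite /layer exprS mulrCA.
  by rewrite ler_peMl ?ler1n // mulr_ge0 ?(ltW c0) // exprn_ge0.
rewrite telescope_sumr // expr0 mulr1.
(* At the lowest threshold, an increment that survives the stopping joins two values of modulus at
   most [c], and both are 0 by the gap. *)
have -> : stopped L f c L x = 0.
  rewrite /stopped big1 // => n _; case: (boolP (exceeds L f c n x)) => h; first by rewrite mul0r.
  have [/h1 -> // /h1 ->] := not_exceeds m_ge2 f_level f_mart (ltn_ord n) h; last exact: ltnW.
  by rewrite subrr mulr0.
rewrite subr0 /stopped.
transitivity (f 0%N x + \sum_(0 <= n < L) (f n.+1 x - f n x)).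
  by rewrite telescope_sumr // addrC subrK.
congr (_ + _); rewrite big_mkord; apply: eq_bigr => n _.
(* The highest threshold is never exceeded, so nothing is stopped and all increments remain. *)
rewrite (_ : exceeds _ _ _ _ _ = false) ?mul1r //; apply/negbTE/negP.
move=> /(exceedsP m_ge2 f_level (c * 2 ^+ K) x (ltn_ord n))[j [y [jn _]]].
by rewrite ltNge h2 // (leq_ltn_trans jn).
Qed.

Section Weighted.
Variables (q w : nat -> R) (p Lam Lam' : R) (K0 : nat).
Hypothesis q_ge0 : forall k, 0 <= q k.
Hypothesis q0_gt0 : 0 < q 0%N.
Hypothesis q_noninc : forall i j, (i <= j)%N -> q j <= q i.
Hypothesis p01 : 0 < p <= 1.
Hypothesis w_ge0 : forall n, 0 <= w n.
Hypothesis K0L : (K0 <= M L)%N.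
Hypothesis Lam_ge0 : 0 <= Lam.
Hypothesis atom_le : forall N x0 u (g : X -> R[i]), (N <= L)%N -> atom L N x0 u g ->
  \sum_(0 <= n < K0) w n.+1 * av L (fun x => normc (av_mean q L n.+1 g x) `^ p)
    <= Lam * (u `^ p / (M N)%:R).
Hypothesis w_le : \sum_(0 <= n < K0) w n.+1 <= Lam'.

(** Weights and atom bound are abstract so that both ranges of [p] share the argument: [Lam] will be
    a constant for [p < 1/2] and a multiple of a logarithm for [p = 1/2]. [Lam'] serves the initial
    term [f 0], which is not an atom of the decomposition. *)
Lemma weighted_mean_le :
  \sum_(0 <= n < K0) w n.+1 * av L (fun x => normc (av_mean q L n.+1 (f L) x) `^ p)
  <= (Lam' * (6 * B%:R ^+ 5) `^ p + Lam * (6 `^ p * (B%:R * (2 `^ p / (2 `^ p - 1)))))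
     * av L (fun x => max_fun x `^ p).
Proof.
have p0 : 0 < p by case/andP: p01.
have [c [K [c0 dec]]] := mart_decomp.
pose T k := c * 2 ^+ k : R.
have T0 k : 0 <= T k by rewrite mulr_ge0 ?(ltW c0) // exprn_ge0.
pose b (k N i : nat) := layer_atom L f (T k) (2 * T k) N i.
pose v n (g : X -> R[i]) := av L (fun x => normc (av_mean q L n.+1 g x) `^ p).
have c50 : 0 <= 6 * B%:R ^+ 5 :> R by rewrite mulr_ge0 // exprn_ge0.
set S := av L (fun x => max_fun x `^ p).
have step1 n : v n (f L) <= v n (f 0%N) + \sum_(k < K) \sum_(N < L) \sum_(i < M N) v n (b k N i).
  apply: le_trans (_ : av L (fun x => normc (av_mean q L n.+1 (f 0%N) x) `^ p +
    \sum_(k < K) \sum_(N < L) \sum_(i < M N) normc (av_mean q L n.+1 (b k N i) x) `^ p) <= _).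
    apply: av_le => // x; rewrite (eq_av_mean _ _ _ _ dec) av_meanD.
    apply: le_trans (_ : (normc (av_mean q L n.+1 (f 0%N) x) + \sum_(k < K) \sum_(N < L) \sum_(i < M N)
        normc (av_mean q L n.+1 (b k N i) x)) `^ p <= _).
      rewrite ge0_ler_powR ?nnegrE ?(ltW p0) ?normc_ge0 //.
        rewrite addr_ge0 ?normc_ge0 // sumr_ge0 // => k _; rewrite sumr_ge0 // => N _.
        by rewrite sumr_ge0 // => i _; exact: normc_ge0.
      apply: le_trans (normcD _ _) _; rewrite lerD2l av_mean_sum.
      apply: le_trans (normc_sum _ _ _) _; apply: ler_sum => k _; rewrite av_mean_sum.
      apply: le_trans (normc_sum _ _ _) _; apply: ler_sum => N _; rewrite av_mean_sum.
      exact: normc_sum.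
    have n0 k N i : 0 <= normc (av_mean q L n.+1 (b k N i) x) by exact: normc_ge0.
    have n1 k N : 0 <= \sum_(i < M N) normc (av_mean q L n.+1 (b k N i) x) by rewrite sumr_ge0.
    have n2 k : 0 <= \sum_(N < L) \sum_(i < M N) normc (av_mean q L n.+1 (b k N i) x) by rewrite sumr_ge0.
    apply: le_trans (powR_subadditive p01 (normc_ge0 _) _) _; first by rewrite sumr_ge0.
    rewrite lerD2l; apply: le_trans (powR_sum_le _ p01 _) _ => //; apply: ler_sum => k _.
    apply: le_trans (powR_sum_le _ p01 _) _ => //; apply: ler_sum => N _.
    exact: powR_sum_le.
  rewrite avD lerD2l av_sum; apply: ler_sum => k _; rewrite av_sum; apply: ler_sum => N _.
  by rewrite av_sum.
apply: le_trans (_ : \sum_(0 <= n < K0) w n.+1 * (v n (f 0%N) +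
   \sum_(k < K) \sum_(N < L) \sum_(i < M N) v n (b k N i)) <= _).
  by apply: ler_sum => n _; rewrite ler_wpM2l //; exact: step1.
under eq_bigr do rewrite mulrDr; rewrite big_split /= mulrDl lerD //.
  (* As [f 0] is constant, its modulus is at most [max_fun x] at every [x], and the uniform bound
     for the means applies with that height. *)
  apply: le_trans (_ : \sum_(0 <= n < K0) w n.+1 * ((6 * B%:R ^+ 5) `^ p * S) <= _).
    apply: ler_sum_nat => n /andP[_ nK]; rewrite ler_wpM2l // -avZ; apply: av_le => // x.
    rewrite -powRM ?max_fun_ge0 // ge0_ler_powR ?nnegrE ?(ltW p0) ?normc_ge0 ?mulr_ge0 ?max_fun_ge0 //.
    apply: (normc_av_mean_le m_ge2 m_le q_ge0 q0_gt0 q_noninc); first by rewrite /= (leq_trans nK).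
    move=> t; rewrite (f_level (_ : agree 0 t x)); last exact/agreeP.
    exact: le_max_fun.
  rewrite -mulr_suml mulrA ler_wpM2r ?av_ge0 // => [x|]; first exact: powR_ge0.
  by rewrite ler_wpM2r ?powR_ge0.
rewrite (_ : \sum_(0 <= n < K0) _ = \sum_(k < K) \sum_(N < L) \sum_(i < M N)
    \sum_(0 <= n < K0) w n.+1 * v n (b k N i)); last first.
  under eq_bigr do rewrite mulr_sumr; rewrite exchange_big; apply: eq_bigr => k _ /=.
  under eq_bigr do rewrite mulr_sumr; rewrite exchange_big; apply: eq_bigr => N _ /=.
  by under eq_bigr do rewrite mulr_sumr; rewrite exchange_big.
(* For fixed [k] the first-exit sets are disjoint over [N]. Each is charged, at cost [B], to its
   points where [f N.+1] exceeds [T k], and all of these lie where [max_fun] exceeds [T k]. *)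
apply: le_trans (_ : \sum_(k < K) (Lam * 6 `^ p * B%:R) * av L (fun x => T k `^ p * (T k < max_fun x)%R%:R) <= _).
  apply: ler_sum => k _.
  apply: le_trans (_ : \sum_(N < L) Lam * ((6 * T k) `^ p * av L (fun x => (first_exceeds L f (T k) N x)%:R)) <= _).
    apply: ler_sum => N _.
    apply: le_trans (_ : \sum_(i < M N) Lam * ((6 * T k * (first_exceeds L f (T k) N (pt m i))%:R) `^ p / (M N)%:R) <= _).
      apply: ler_sum => i _; apply: atom_le; first exact: ltnW.
      by apply: layer_atomP.
    rewrite -mulr_sumr ler_wpM2l // (av_level m_ge2 (ltnW (ltn_ord N))); last first.
      by move=> x y /(first_exceeds_level m_ge2 f_level (T k) (ltn_ord N)) ->.
    rewrite /av [leRHS]mulrA [leRHS]mulr_sumr; apply: ler_sum => i _.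
    by case: first_exceeds; rewrite ?mulr1 // !mulr0 powR0 ?mul0r // gt_eqF.
  rewrite -mulr_sumr -mulr_sumr -!mulrA ler_wpM2l // powRM // -mulrA ler_wpM2l ?powR_ge0 //.
  rewrite avZ mulrCA ler_wpM2l ?powR_ge0 //.
  apply: le_trans (_ : \sum_(N < L) B%:R * av L (fun x => (first_exceeds L f (T k) N x)%:R * (T k < normc (f N.+1 x))%R%:R) <= _).
    by apply: ler_sum => N _; exact: av_first_exceeds.
  rewrite -mulr_sumr ler_wpM2l // -av_sum; apply: av_le => // x.
  case: (boolP (T k < max_fun x)) => h.
    apply: le_trans (_ : \sum_(N < L) (first_exceeds L f (T k) N x)%:R <= _);
      last exact: sum_first_exceeds_le.
    apply: ler_sum => N _.
    by rewrite ler_piMr //; case: (_ < _).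
  rewrite big1 // => N _; rewrite (_ : (T k < _) = false) ?mulr0 //.
  by apply/negbTE; apply: contra h => /lt_le_trans; apply; exact: le_max_fun.
rewrite -mulr_sumr -av_sum.
apply: le_trans (_ : Lam * 6 `^ p * B%:R * (2 `^ p / (2 `^ p - 1) * S) <= _); last first.
  by rewrite !mulrA.
rewrite ler_wpM2l ?mulr_ge0 ?powR_ge0 // -avZ; apply: av_le => // x.
by apply: layer_sum_le => //; exact: max_fun_ge0.
Qed.

End Weighted.
End Fixed.
End FiniteTheorem.

(** * Haar integrals of functions of finitely many coordinates *)

Section HaarIntegral.
Variables (R : realType) (m : nat -> nat).
Hypothesis m_ge2 : forall k, (2 <= m k)%N.
Variable mu : probability (vilenkin m) R.
Hypothesis mu_haar : is_haar mu.
Local Notation M := (bigM m).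
Local Notation X := (vilenkin m).

Lemma cylinderE n (x : X) : cylinder n x = [set y | agree n x y].
Proof.
by apply/seteqP; split => y /=; [move=> h|move=> /agreeP h k kn]; [apply/agreeP => k kn; rewrite h|rewrite h].
Qed.

Lemma cylinder_open n (x : X) : open (cylinder n x : set (vilenkin_top m)).
Proof.
elim: n => [|n IH].
  by rewrite (_ : cylinder 0 x = setT); [exact: openT|apply/seteqP; split].
have -> : cylinder n.+1 x = cylinder n x `&` (proj n @^-1` [set x n]).
  rewrite !cylinderE; apply/seteqP; split => y /=; rewrite agreeS; first by move=> /andP[-> /eqP ->].
  by move=> [-> h] /=; apply/eqP; exact: esym h.
apply: openI => //.
have H := proj1 (@continuousP (prod_topology (fun k => discrete_Z (m k))) _ _)
  (@proj_continuous nat (fun k => discrete_Z (m k)) n).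
apply: H; exact: discrete_open.
Qed.

Lemma level_open (T : Type) n (g : X -> T) (Y : set T) : level n g ->
  open (g @^-1` Y : set (vilenkin_top m)).
Proof.
move=> gn; have -> : g @^-1` Y = \bigcup_(x in g @^-1` Y) cylinder n x.
  apply/seteqP; split => [x gx|y [x gx]]; first by exists x => //; rewrite cylinderE /= agree_refl.
  by rewrite cylinderE /= => /gn xy; rewrite /preimage /= -xy.
by apply: bigcup_open => x _; exact: cylinder_open.
Qed.

Lemma level_measurable_set (T : Type) n (g : X -> T) (Y : set T) : level n g ->
  measurable (g @^-1` Y : set X).
Proof. by move=> gn; apply: sub_sigma_algebra; exact: level_open gn. Qed.

Lemma level_measurable d (T : measurableType d) n (g : X -> T) : level n g ->
  measurable_fun setT g.
Proof. by move=> gn _ Y _; rewrite setTI; exact: level_measurable_set gn. Qed.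

Lemma cylinder_measurable_set n (x : X) : measurable (cylinder n x : set X).
Proof. by apply: sub_sigma_algebra; exact: cylinder_open. Qed.

Lemma haar_cylinder_eq n (x y : X) : mu (cylinder n x) = mu (cylinder n y).
Proof.
pose a : X := fun k => (y k : 'Z_(m k)) - x k.
rewrite -(mu_haar a (cylinder_measurable_set n x)); congr (mu _).
apply/seteqP; split => z /=.
  by move=> [t tx <-] k kn; rewrite /vadd tx // /a subrK.
move=> zy; exists (fun k => (z k : 'Z_(m k)) - a k).
  by move=> k kn; rewrite zy // /a opprB addrCA subrr addr0.
by apply/functional_extensionality_dep => k; rewrite /vadd addrC subrK.
Qed.

Lemma indic_cylinder n (x y : X) : \1_(cylinder n x) y = (agree n x y)%:R :> R.
Proof. by rewrite indicE cylinderE; congr (nat_of_bool _)%:R; apply/idP/idP; rewrite in_setE. Qed.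

(** The [M n] cylinders of level [n] partition the group and are translates of one another. *)
Lemma haar_cylinder n (x : X) : mu (cylinder n x) = (M n)%:R^-1%:E.
Proof.
have fin : mu (cylinder n x) \is a fin_num.
  exact: fin_num_measure (cylinder_measurable_set n x).
have H : ((M n)%:R%:E * mu (cylinder n x) = 1)%E.
  rewrite -(probability_setT mu) -[RHS]mul1e -(integral_cst mu measurableT).
  rewrite (_ : (fun=> 1%E) = (fun y => \sum_(i < M n) (\1_(cylinder n (pt m i)) y)%:E)%E); last first.
    apply/funext => y; rewrite sumEFin; congr (_%:E).
    by rewrite -(sum_agree m_ge2 R n y); apply: eq_bigr => i _; rewrite indic_cylinder.
  rewrite ge0_integral_sum //; last first.
    move=> i; apply: (level_measurable (n := n)) => y z yz.
    by rewrite !indic_cylinder (agree_level (pt m i) yz).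
  rewrite (eq_bigr (fun=> mu (cylinder n x))) => [|i _].
    rewrite -(fineK fin) sumEFin -EFinM; congr (_%:E).
    by rewrite sumr_const card_ord mulr_natl.
  rewrite integral_indic ?setIT //; first exact: haar_cylinder_eq.
  exact: cylinder_measurable_set.
move: H; rewrite -(fineK fin) -EFinM => -[H]; congr (_%:E).
by apply: (mulfI (natM_neq0 m_ge2 R n)); rewrite H divff // natM_neq0.
Qed.

Lemma ge0_integral_level n (g : X -> R) : level n g -> (forall x, 0 <= g x) ->
  (\int[mu]_x (g x)%:E = (av n g)%:E)%E.
Proof.
move=> gn g0.
have -> : (fun x => (g x)%:E) = (fun x => \sum_(i < M n) (g (pt m i))%:E * (\1_(cylinder n (pt m i)) x)%:E)%E.
  apply/funext => x; rewrite (level_sum m_ge2 x gn) -sumEFin; apply: eq_bigr => i _.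
  by rewrite indic_cylinder EFinM.
rewrite ge0_integral_sum //.
- rewrite /av mulr_sumr -sumEFin; apply: eq_bigr => i _.
  rewrite ge0_integralZl_EFin //.
  - rewrite integral_indic ?setIT //; last exact: cylinder_measurable_set.
    apply: (etrans (congr1 (fun z => (g (pt m i))%:E * z)%E (haar_cylinder _ _))).
    by rewrite -EFinM mulrC.
  - apply: (level_measurable (n := n)) => y z yz.
    by rewrite !indic_cylinder (agree_level (pt m i) yz).
- move=> i; apply: (level_measurable (n := n)) => y z yz.
  by rewrite !indic_cylinder (agree_level (pt m i) yz).
- by move=> i x _; rewrite indic_cylinder mule_ge0 // lee_fin.
Qed.

Lemma level_integrable n (g : X -> R) : level n g -> mu.-integrable setT (EFin \o g).
Proof.
move=> gn; apply/integrableP; split; first by apply: (level_measurable (n := n)) => x y /gn /= ->.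
under eq_integral do rewrite /= -/(abse (EFin _)) abse_EFin.
rewrite (@ge0_integral_level n (fun x => `|g x|)) ?ltry // => x y /gn -> //.
Qed.

Lemma Rintegral_level n (g : X -> R) : level n g -> \int[mu]_x g x = av n g.
Proof.
move=> gn; pose gp x := Num.max (g x) 0; pose gm x := Num.max (- g x) 0.
have gE x : g x = gp x - gm x.
  by rewrite /gp /gm; case: (leP (g x) 0) => h; rewrite /Num.max ?oppr_lt0; case: ltP; lra.
have gpn : level n gp by move=> x y /gn; rewrite /gp => ->.
have gmn : level n gm by move=> x y /gn; rewrite /gm => ->.
have nn (h : X -> R) : level n h -> (forall x, 0 <= h x) -> \int[mu]_x h x = av n h.
  by move=> hn h0; rewrite /Rintegral (ge0_integral_level hn h0).
rewrite (eq_av n gE) avB -!nn //; try by move=> x; rewrite le_max lexx orbT.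
rewrite -RintegralB //; [|exact: level_integrable gpn|exact: level_integrable gmn].
by congr (Rintegral _ _ _); apply/funext.
Qed.

Lemma Re_av n (g : X -> R[i]) : complex.Re (av n g) = av n (fun x => complex.Re (g x)).
Proof.
have Rs (I : Type) (s : seq I) (F : I -> R[i]) :
    complex.Re (\sum_(i <- s) F i) = \sum_(i <- s) complex.Re (F i).
  by apply: (big_morph _ _ erefl) => -[a b] [c d].
rewrite /av -Rs; have -> : (M n)%:R^-1 = ((M n)%:R^-1)%:C :> R[i].
  by rewrite fmorphV rmorph_nat.
by case: (\sum_(_ < _) _) => a b /=; rewrite mul0r subr0.
Qed.

Lemma Im_av n (g : X -> R[i]) : complex.Im (av n g) = av n (fun x => complex.Im (g x)).
Proof.
have Rs (I : Type) (s : seq I) (F : I -> R[i]) :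
    complex.Im (\sum_(i <- s) F i) = \sum_(i <- s) complex.Im (F i).
  by apply: (big_morph _ _ erefl) => -[a b] [c d].
rewrite /av -Rs; have -> : (M n)%:R^-1 = ((M n)%:R^-1)%:C :> R[i].
  by rewrite fmorphV rmorph_nat.
by case: (\sum_(_ < _) _) => a b /=; rewrite mul0r addr0.
Qed.

Lemma cintegral_level n (g : X -> R[i]) : level n g -> cintegral mu g = av n g.
Proof.
move=> gn; rewrite /cintegral !(@Rintegral_level n); last 2 first.
- by move=> x y /gn ->.
- by move=> x y /gn ->.
by rewrite -Re_av -Im_av; case: (av n g).
Qed.

(** Sets saturated for [agree n] form a sigma-algebra containing the cylinders. Applied to the fibre
    of a value, this forces the function to be constant on each cylinder. *)
Lemma cylinder_measurable_level n (g : X -> R[i]) : cylinder_measurable n g -> level n g.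
Proof.
move=> [hR hI].
have sat (A : set X) : <<s range (@cylinder m n) >> A -> forall x y, agree n x y -> A x -> A y.
  move=> hA; apply: (smallest_sub (X := [set A | forall x y : X, agree n x y -> A x -> A y]) _ _ hA).
    split.
    - by [].
    - by move=> C hC x y xy [_ Cx]; split => // Cy; apply: Cx; apply: hC Cy; rewrite agree_sym.
    - by move=> F hF x y xy [k _ Fx]; exists k => //; exact: hF Fx.
  by move=> _ [z _ <-] x y xy; rewrite !cylinderE /= => zx; exact: agree_trans xy.
have key (h : X -> R) : measurable_fun setT (h : cylinder_sigma m n -> R) -> level n h.
  move=> hm x y xy; have := hm measurableT _ (measurable_set1 (h x)).
  by rewrite setTI => /sat -/(_ x y xy erefl) /= ->.
move=> x y xy; have := key _ hR x y xy; have := key _ hI x y xy.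
by case: (g x) => a b; case: (g y) => a' b' /= -> ->.
Qed.

End HaarIntegral.

(** * From finite averages to the norms of means and martingales *)

Section Transfer.
Variables (R : realType) (m : nat -> nat).
Hypothesis m_ge2 : forall k, (2 <= m k)%N.
Variable mu : probability (vilenkin m) R.
Hypothesis mu_haar : is_haar mu.
Local Notation M := (bigM m).
Local Notation X := (vilenkin m).

Lemma fourier_coef_av L (g : X -> R[i]) i : level L g -> (i < M L)%N ->
  fourier_coef mu g i = av_coef L g i.
Proof.
move=> gL iL; apply: (cintegral_level m_ge2 mu_haar) => x y xy.
by rewrite (gL _ _ xy) (psi_level R m_ge2 iL xy).
Qed.

Section Martingale.
Variable f : nat -> X -> R[i].
Hypothesis f_martingale : is_martingale mu f.

Lemma martingale_level n : level n (f n).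
Proof. by case: f_martingale => _ h _; exact: cylinder_measurable_level. Qed.

Lemma martingale_av n l x : (n <= l)%N ->
  f n x = (M n)%:R * av l (fun t => f l t * (agree n x t)%:R).
Proof.
move=> nl; case: f_martingale => _ _ /(_ n l nl) <-.
transitivity (partial_sum (av_coef l (f l)) (M n) x).
  apply: eq_bigr => k _; rewrite (fourier_coef_av (@martingale_level l)) //.
  by rewrite (leq_trans (ltn_ord k)) // leq_bigM.
rewrite partial_sum_av -avZ; apply: eq_av => t.
by rewrite dirichlet_bigM // mulrCA.
Qed.

(** Tested against a function of level [L], every later [f k] acts like [f L]; the sequence in the
    limit is eventually constant. *)
Lemma mart_coefE L i : (i < M L)%N -> mart_coef mu f i = av_coef L (f L) i.
Proof.
move=> iL; rewrite /mart_coef.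
apply: (@lim_near_cst R[i]^o); first exact: (@norm_hausdorff _ R[i]^o).
exists L => // k /= Lk.
rewrite (fourier_coef_av (@martingale_level k)); last by rewrite (leq_trans iL) // leq_bigM.
have psiL : level L (fun t : X => (psi R i t)^*) by move=> x y xy; rewrite (psi_level R m_ge2 iL xy).
rewrite /av_coef.
transitivity (av k (fun t => (psi R i t)^* * f L t)); last first.
  rewrite (av_level m_ge2 Lk); first by apply: eq_av => t; rewrite mulrC.
  by move=> x y xy; rewrite (psiL _ _ xy) (martingale_level xy).
rewrite (mart_av m_ge2 (fun n x => martingale_av x) Lk psiL).
by apply: eq_av => t; rewrite mulrC.
Qed.

Lemma T_meanE q L k x : (k <= M L)%N -> T_mean mu q k f x = av_mean q L k (f L) x.
Proof.
move=> kL; rewrite /T_mean /av_mean; congr (_ * _); apply: eq_bigr => j _; congr (_ * _).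
apply: eq_bigr => i _; rewrite (@mart_coefE L) //.
by rewrite (ltn_trans (ltn_ord i)) // (leq_trans (ltn_ord j)).
Qed.

Lemma av_mean_level q L k (g : X -> R[i]) : (k <= M L)%N -> level L (av_mean q L k g).
Proof.
move=> kL x y xy; rewrite /av_mean; congr (_ * _); apply: eq_bigr => j _; congr (_ * _).
apply: eq_bigr => i _; rewrite (psi_level R m_ge2 _ xy) //.
by rewrite (ltn_trans (ltn_ord i)) // (leq_trans (ltn_ord j)).
Qed.

Lemma Lp_norm_T_mean q L k p : p != 0 -> (k <= M L)%N ->
  (Lp_norm mu p (T_mean mu q k f) `^ p =
   (av L (fun x => normc (av_mean q L k (f L) x) `^ p))%:E)%E.
Proof.
move=> p0 kL; rewrite /Lp_norm poweR_Lnorm //.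
under eq_integral do rewrite abse_EFin poweR_EFin (ger0_norm (normc_ge0 _)) (T_meanE _ _ kL).
apply: (ge0_integral_level m_ge2 mu_haar) => [x y /(av_mean_level q (f L) kL) -> //|x].
exact: powR_ge0.
Qed.

Lemma maximal_fun_measurable : measurable_fun setT (maximal_fun f).
Proof.
have -> : maximal_fun f = fun x => esups (fun n => (normc (f n x))%:E) 0.
  by apply/funext => x; rewrite /maximal_fun /esups; congr (ereal_sup _);
    apply/seteqP; split => y [n] // _ <-; exists n.
apply: measurable_fun_esups => n.
by apply: (level_measurable (n := n)) => x y /(@martingale_level n) ->.
Qed.

(** Valid for every [L] with the same right-hand side, which is what makes the finite-level
    estimates uniform. *)
Lemma av_max_fun_le L p : 0 < p ->
  ((av L (fun x => max_fun L f x `^ p))%:E <= Hp_norm mu p f `^ p)%E.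
Proof.
move=> p0; rewrite /Hp_norm poweR_Lnorm ?gt_eqF //.
have mlev : level L (max_fun L f).
  move=> x y xy; rewrite /max_fun; apply: eq_bigr => n _; congr normc.
  by apply: martingale_level; apply: agreeW xy; rewrite -ltnS.
rewrite -(ge0_integral_level m_ge2 mu_haar); last 2 first.
- by move=> x y /mlev ->.
- by move=> x; exact: powR_ge0.
apply: ge0_le_integral => //.
- by move=> x _; rewrite lee_fin powR_ge0.
- by apply: (level_measurable (n := L)) => x y /mlev ->.
- apply: (measurableT_comp (measurable_poweR p)).
  by apply: (measurableT_comp (f := abse)) maximal_fun_measurable.
move=> x _; rewrite -poweR_EFin; apply: gt0_ler_poweR; first exact: ltW.
- by rewrite in_itv /= lee_fin max_fun_ge0 leey.
- by rewrite in_itv /= abse_ge0 leey.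
apply: le_trans (lee_abs _).
rewrite /max_fun; elim/big_ind : _ => [|a b ha hb|n _].
- by apply: ereal_sup_ge; exists (normc (f 0%N x))%:E; [exists 0%N|rewrite lee_fin normc_ge0].
- by rewrite EFin_max ge_max ha.
- by apply: ereal_sup_ubound; exists n.
Qed.

End Martingale.
End Transfer.

Theorem mainTheorem14 (R : realType) (m : nat -> nat)
    (m_ge2 : forall k, (2 <= m k)%N)
    (m_bounded : exists B : nat, forall k, (m k <= B)%N)
    (mu : probability (vilenkin m) R) (mu_haar : is_haar mu) :
  (forall p : R, 0 < p < 2^-1 ->
    exists c : R, forall q : nat -> R,
      (forall k, 0 <= q k) -> 0 < q 0%N ->
      (forall i j, (i <= j)%N -> q j <= q i) ->
      forall f, Hp mu p f ->
        (\sum_(1 <= k <oo)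
            (Lp_norm mu p (T_mean mu q k f) `^ p
              * ((k%:R `^ (2 - 2 * p))^-1)%:E)
         <= c%:E * Hp_norm mu p f `^ p)%E)
  /\
  (forall q : nat -> R,
      (forall k, 0 <= q k) -> 0 < q 0%N ->
      (forall i j, (i <= j)%N -> q j <= q i) ->
      (fun n => (Qsum q n)^-1%R) =O_\oo (fun n => (n%:R : R)^-1%R) ->
    exists c : R, forall f, Hp mu 2^-1 f -> forall n : nat, (2 <= n)%N ->
      (((ln n%:R)^-1)%:E *
         \sum_(1 <= k < n.+1)
            (Lp_norm mu 2^-1 (T_mean mu q k f) `^ 2^-1 * (k%:R^-1)%:E)
       <= c%:E * Hp_norm mu 2^-1 f `^ 2^-1)%E).
Proof.
case: m_bounded => B m_le; split.
  move=> p hp; case/andP: (hp) => p0 p2.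
  have [C C0 hC] := @sum_atom_small R m B m_ge2 m_le p hp.
  have hp1 : 0 < p <= 1 by rewrite p0 (le_trans (ltW p2)) // invf_le1 // ler1n.
  (* Since [2 - 2p = 1 + r], the weights sum to at most [1 + 1/r]: the index 1 gives 1, and
     [tail_sum] bounds the rest. *)
  pose r := 1 - 2 * p; have r0 : 0 < r.
    by rewrite subr_gt0 mulrC -ltr_pdivlMr // div1r.
  pose c := (1 + r^-1) * (6 * B%:R ^+ 5) `^ p + C * (6 `^ p * (B%:R * (2 `^ p / (2 `^ p - 1)))).
  have c0 : 0 <= c.
    have b1 : 1 < 2 `^ p :> R by exact: powR2_gt1.
    rewrite addr_ge0 // mulr_ge0 ?powR_ge0 //.
      by rewrite addr_ge0 // invr_ge0 ltW.
    by rewrite !mulr_ge0 ?powR_ge0 // invr_ge0 subr_ge0 ltW.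
  exists c => q q0 q1 qd f [fm _].
  have pn0 : p != 0 by rewrite gt_eqF.
  (* The terms are nonnegative, so bounding partial sums suffices. The first [K] indices fit at
     level [L = K], because [K <= M_K]. *)
  apply: lime_le.
    apply: is_cvg_nneseries => k _ _; by rewrite mule_ge0 ?poweR_ge0 // lee_fin invr_ge0 powR_ge0.
  apply: nearW => -[|K]; first by rewrite big_geq // mule_ge0 ?poweR_ge0.
  have KM : (K <= bigM m K)%N by rewrite ltnW // ltn_bigM.
  pose w n : R := (n%:R `^ (2 - 2 * p))^-1.
  have w0 n : 0 <= w n by rewrite invr_ge0 powR_ge0.
  have wW : \sum_(0 <= n < K) w n.+1 <= 1 + r^-1.
    case: (K) => [|K']; first by rewrite big_geq // addr_ge0 // invr_ge0 ltW.
    rewrite big_ltn // lerD //; first by rewrite /w powR1 invr1.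
    have := tail_sum r0 (isT : (0 < 1)%N) (isT : (1 <= K'.+1)%N); rewrite powR1 mulr1.
    apply: le_trans; apply: ler_sum => n _; rewrite /w -powRN.
    by rewrite (_ : - (2 - 2 * p) = - (1 + r)) // /r; ring.
  have H := @weighted_mean_le R m B m_ge2 m_le K f (martingale_level fm)
    (fun n x => martingale_av m_ge2 mu_haar fm x) q w p C (1 + r^-1) K q0 q1 qd hp1 w0 KM C0
    (fun N x0 u g NL ga => hC q K N x0 u g K q0 q1 qd NL ga KM) wW.
  have -> : (\sum_(1 <= k < K.+1) (Lp_norm mu p (T_mean mu q k f) `^ p
      * ((k%:R `^ (2 - 2 * p))^-1)%:E))%E =
      (\sum_(0 <= n < K) w n.+1 * av K (fun x => normc (av_mean q K n.+1 (f K) x) `^ p))%:E.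
    rewrite big_add1 /= -sumEFin big_nat [RHS]big_nat; apply: eq_bigr => k /andP[_ kK].
    rewrite (Lp_norm_T_mean m_ge2 mu_haar fm _ pn0 (leq_trans kK KM)).
    by rewrite -EFinM mulrC.
  apply: (@le_trans _ _ (c * av K (fun x => max_fun K f x `^ p))%:E); first by rewrite lee_fin.
  rewrite EFinM; apply: lee_wpmul2l; first by rewrite lee_fin.
  exact: av_max_fun_le.
move=> q q0 q1 qd /eqO_exP[k0 k00 [n0 _ hn0]].
(* The asymptotic bound starts at [n0]. For [0 < n < n0], [1 / Q_n <= 1 / q_0 <= (n0 / q_0) / n]. *)
pose D0 := k0 + n0%:R / q 0%N.
have D00 : 0 <= D0 by rewrite addr_ge0 ?(ltW k00) // divr_ge0 // ltW.
have hQ n : (0 < n)%N -> (Qsum q n)^-1 <= D0 / n%:R.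
  move=> n1; have nR : 0 < n%:R :> R by rewrite ltr0n.
  have Q0 := Qsum_gt0 q0 q1 n1.
  have [nn|nn] := leqP n0 n.
    have := hn0 n nn; rewrite /= !ger0_norm ?invr_ge0 // ?(ltW Q0) // => /le_trans; apply.
    by rewrite ler_wpM2r ?invr_ge0 // lerDl divr_ge0 // ltW.
  apply: (@le_trans _ _ (q 0%N)^-1).
    rewrite lef_pV2 ?posrE //.
    by rewrite /Qsum -(prednK n1) big_ord_recl lerDl sumr_ge0.
  rewrite ler_pdivlMr // (@le_trans _ _ (n0%:R / q 0%N)) //.
    by rewrite mulrC ler_wpM2r ?invr_ge0 ?(ltW q1) // ler_nat ltnW.
  by rewrite lerDr ltW.
pose D := q 0%N * D0.
have D_ge0 : 0 <= D by rewrite mulr_ge0 // ltW.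
have qD k n : (0 < n)%N -> q k / Qsum q n <= D / n%:R.
  by move=> n1; rewrite -mulrA ler_pM ?hQ ?qd // invr_ge0 ltW // Qsum_gt0.
have [C C0 hC] := @sum_atom_half R m B m_ge2 m_le D D_ge0.
set p : R := 2^-1 in hC *.
have p0 : 0 < p by rewrite invr_gt0.
have hp1 : 0 < p <= 1 by rewrite p0 invf_le1 // ler1n.
have pn0 : p != 0 by rewrite gt_eqF.
have l2 : 0 < ln 2 :> R by rewrite ln_gt0 // ltr1n.
pose c1 := (6 * B%:R ^+ 5) `^ p + C * (6 `^ p * (B%:R * (2 `^ p / (2 `^ p - 1)))).
have c10 : 0 <= c1.
  have b1 : 1 < 2 `^ p :> R by exact: powR2_gt1.
  rewrite addr_ge0 ?powR_ge0 // mulr_ge0 //.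
  by rewrite !mulr_ge0 ?powR_ge0 // invr_ge0 subr_ge0 ltW.
(* For [K >= 2], [1 <= ln K / ln 2], so [1 + ln K <= (1 / ln 2 + 1) ln K] and the logarithm
   cancels. *)
exists (((ln 2)^-1 + 1) * c1) => f [fm _] K K2.
have lK : 0 < ln K%:R :> R by rewrite ln_gt0 // ltr1n.
have K1 : (0 < K)%N by exact: leq_trans K2.
have KM : (K <= bigM m K)%N by rewrite ltnW // ltn_bigM.
pose w n : R := n%:R^-1.
have w0 n : 0 <= w n by rewrite invr_ge0.
have wW : \sum_(0 <= n < K) w n.+1 <= 1 + ln K%:R.
  by have := harmonic_le_ln R K1; rewrite big_add1.
have L0 : 0 <= C * (1 + ln K%:R) by rewrite mulr_ge0 // addr_ge0 // ltW.
have K1M : (0 < K <= bigM m K)%N by rewrite K1.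
have H := @weighted_mean_le R m B m_ge2 m_le K f (martingale_level fm)
    (fun n x => martingale_av m_ge2 mu_haar fm x) q w p _ _ K q0 q1 qd hp1 w0 KM L0
    (fun N x0 u g NL ga => hC q K N x0 u g K q0 q1 qd qD NL ga K1M) wW.
have -> : (\sum_(1 <= k < K.+1) (Lp_norm mu p (T_mean mu q k f) `^ p * (k%:R^-1)%:E))%E =
    (\sum_(0 <= n < K) w n.+1 * av K (fun x => normc (av_mean q K n.+1 (f K) x) `^ p))%:E.
  rewrite big_add1 /= -sumEFin big_nat [RHS]big_nat; apply: eq_bigr => k /andP[_ kK].
  rewrite (Lp_norm_T_mean m_ge2 mu_haar fm _ pn0 (leq_trans kK KM)).
  by rewrite -EFinM mulrC.
set S := av K (fun x => max_fun K f x `^ p) in H.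
apply: (@le_trans _ _ ((((ln 2)^-1 + 1) * c1) * S)%:E); last first.
  rewrite EFinM; apply: lee_wpmul2l; last exact: av_max_fun_le.
  by rewrite lee_fin mulr_ge0 // addr_ge0 // invr_ge0 ltW.
have S0 : 0 <= S by rewrite av_ge0 // => x; exact: powR_ge0.
rewrite -EFinM lee_fin ler_pdivrMl //; apply: (le_trans H).
rewrite [leLHS](_ : _ = (1 + ln K%:R) * (c1 * S)); last by rewrite /c1; ring.
rewrite [leRHS](_ : _ = ln K%:R * ((ln 2)^-1 + 1) * (c1 * S)); last by ring.
apply: ler_wpM2r; first exact: mulr_ge0.
rewrite mulrDr mulr1 lerD2r ler_pdivlMr // mul1r ler_ln ?posrE ?ltr0n //.
by rewrite ler_nat.
Qed.
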